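(* The Stokes-Sibuya multiplier $C_0(\underline a)$ of $(\mathfrak{E}_m)$ satisfies: (1) when $m=1$, for all $\underline a\in\mathbb{C}$: $C_0(\underline a)=-2\cos(\pi p)$; (2) when $m=2$, for all $\underline a'\in\mathbb{C}$ and $p\notin-\mathbb{N}$: $$C_0(\underline a)\,\widetilde L_0(\omega.\underline a',p)=-2i\,e^{-i\pi\frac{a_1}2}\cos\Big(\frac\pi2(p+a_1)\Big)\widetilde L_0(\underline a',p);$$ (3) when $m\ge3$, for all $\underline a'\in\mathbb{C}^{m-1}$ and $p\notin-\mathbb{N}$: $$C_0(\underline a)\,\widetilde L_0(\omega.\underline a',p)=\omega^{r(\underline a)-1+\frac m4}\Big(\widetilde L_0(\underline a',p)\,\omega^{-r(\underline a)+\frac12-\frac m4+\frac p2}+\widetilde L_0(\omega^2.\underline a',p)\,\omega^{r(\underline a)-\frac12+\frac m4-\frac p2}\Big).$$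
   Context: $(\mathfrak{E}_m)$ is the equation $\Phi''(x)=\frac{P_m(x,\underline a)}{x^2}\Phi(x)$, $P_m(x,\underline a)=x^m+a_1x^{m-1}+\cdots+a_m$, $\underline a\in\mathbb{C}^m$; $x$ lies on the universal covering of $\mathbb{C}^\star$. $\mathbb{N}=\{0,1,2,\dots\}$. $\omega=e^{2i\pi/m}$, $\omega^c:=e^{2i\pi c/m}$, $\tau.\underline a:=(\tau a_1,\dots,\tau^ma_m)$, $\underline a'=(a_1,\dots,a_{m-1})$, $\tau.\underline a':=(\tau a_1,\dots,\tau^{m-1}a_{m-1})$. Solutions at infinity: define $b_{\frac m2-k}(\underline a)$ by $\frac{\sqrt{P_m(x,\underline a)}}{x}=x^{\frac m2-1}+\sum_{k\ge1}b_{\frac m2-k}(\underline a)x^{\frac m2-k-1}$ at infinity; $r(\underline a)=\frac12-\frac m4$ ($m$ odd), $r(\underline a)=\frac12-\frac m4-b_0(\underline a)$ ($m$ even); $S(x,\underline a)=\frac2mx^{\frac m2}+\sum_{1\le k<m/2}\frac{b_{\frac m2-k}(\underline a)}{\frac m2-k}x^{\frac m2-k}$. $\Phi_0(x,\underline a)$ is the unique solution of $(\mathfrak{E}_m)$ asymptotic at infinity to $x^{r(\underline a)}e^{-S(x,\underline a)}\phi_0$ ($\phi_0$ a formal series in $x^{-1/2}$, resp. $x^{-1}$ for $m$ even, with constant term $1$) in every strict sub-sector of $\{|\arg x|<3\pi/m\}$, locally uniformly in $\underline a$; it extends analytically to the universal covering of $\mathbb{C}^\star$ and is entire in $\underline a$.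 $\Phi_k(x,\underline a)=\Phi_0(\omega^kx,\omega^k.\underline a)$; $C_0,\widetilde C_0$ are defined by $\Phi_{-1}=C_0(\underline a)\Phi_0+\widetilde C_0(\underline a)\Phi_1$. Solutions at the origin: $p=(1+4a_m)^{1/2}$ (so $a_m=\frac{p^2-1}4$), with $-p\notin\mathbb{N}^\star$, $s(p)=\frac{1+p}2$. $(f_1,f_2)$ is the fundamental system of solutions uniquely determined by $f_1=x^{s(p)}(1+\sum_{k\ge1}A_kx^k)$ and $f_2=\lambda(\underline a',p)f_1\ln x+x^{s(-p)}g_2$ with $g_2$ entire in $x$, where: if $p\notin\mathbb{Z}$, $\lambda=0$ and $g_2(x,\underline a',p)=g_1(x,\underline a',-p)$ with $g_1=x^{-s(p)}f_1$; if $p\in\mathbb{N}^\star$, $g_2=1+\sum_{k\ge1}B_kx^k$ with $B_p=0$; if $p=0$, $\lambda=1$ and $g_2(0)=0$. The coefficients $L_0,\widetilde L_0$ are defined by $\Phi_{-1}(x,\underline a)=L_0(\underline a',p)f_1(x,\underline a',p)+\widetilde L_0(\underline a',p)f_2(x,\underline a',p)$. *)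

(* Defs.v *)
From Stdlib Require Export Reals ZArith.
From Coquelicot Require Export Coquelicot.
Open Scope C_scope.

(* A point x of the universal covering of C^* is represented by its logarithm
   t : C, so that x = e^t, |x| = e^(Re t), arg x = Im t, ln x = t, and the
   covering projection is [Cexp].  A function on the covering is a function
   C -> C of t.  A vector (a_1, ..., a_m) is an element of [Tn m C], whose
   components are numbered from 0: a_k is [coeff_Tn 0 a (k - 1)]. *)

Definition Cexp (z : C) : C :=
  (exp (Re z) * cos (Im z), exp (Re z) * sin (Im z))%R.

Definition Ccos (z : C) : C := (Cexp (Ci * z) + Cexp (- (Ci * z))) / 2.

Definition cover_pow (t s : C) : C := Cexp (s * t).

(* [f' = df/dx] on the covering: since x = e^t, df/dt = x df/dx. *)
Definition is_x_derive (f f' : C -> C) : Prop :=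
  forall t : C,
    is_derive (K := C_AbsRing) (V := C_NormedModule) f t (Cexp t * f' t).

Definition omega_pow (m : nat) (c : C) : C :=
  Cexp (2 * Ci * PI * c / INR m).

(* The point omega^k x of the covering (for m = 1, omega = e^(2 i pi) acts
   nontrivially). *)
Definition rotate (m : nat) (k : Z) (t : C) : C :=
  t + 2 * Ci * PI * IZR k / INR m.

Definition weighted_scale {n : nat} (tau : C) (a : Tn n C) : Tn n C :=
  mk_Tn n (fun i => Cpow tau (S i) * coeff_Tn (RtoC 0) a i).

Definition coef {m : nat} (a : Tn m C) (k : nat) : C :=
  match k with
  | O => 1
  | S j => coeff_Tn (RtoC 0) a j
  end.

Definition P {m : nat} (a : Tn m C) (x : C) : C :=
  sum_n (fun k => coef a k * Cpow x (m - k)) m.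

Definition is_solution {m : nat} (a : Tn m C) (Phi : C -> C) : Prop :=
  exists Phi' : C -> C,
    is_x_derive Phi Phi' /\
    is_x_derive Phi' (fun t => P a (Cexp t) / Cpow (Cexp t) 2 * Phi t).

(* [b k] stands for b_(m/2 - k), with [b 0 = 1]: near infinity,
   x^(m/2 - 1) (1 + sum_(k >= 1) b_(m/2 - k) x^(-k)) is the square root of
   P_m(x)/x^2 equivalent to x^(m/2 - 1). *)
Definition is_sqrt_expansion {m : nat} (a : Tn m C) (b : nat -> C) : Prop :=
  b 0%nat = 1 /\
  exists T : R, forall t : C, (T < Re t)%R ->
    exists w : C,
      is_pseries (K := C_AbsRing) (V := C_NormedModule) b (/ Cexp t) w /\
      Cpow (cover_pow t (INR m / 2 - 1) * w) 2
      = P a (Cexp t) / Cpow (Cexp t) 2.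

Definition r_exp (m : nat) (b : nat -> C) : C :=
  if Nat.odd m then 1 / 2 - INR m / 4
  else 1 / 2 - INR m / 4 - b (Nat.div2 m).

(* The indices 1 <= k < m/2 are those with 1 <= k <= floor((m - 1)/2). *)
Definition S_exp (m : nat) (b : nat -> C) (t : C) : C :=
  2 / INR m * cover_pow t (INR m / 2) +
  sum_n_m (fun k => b k / (INR m / 2 - INR k)
                    * cover_pow t (INR m / 2 - INR k))
    1 (Nat.div2 (m - 1)).

(* phi_0 is a series in x^(-series_step m). *)
Definition series_step (m : nat) : R := if Nat.odd m then (/ 2)%R else 1%R.

(* Phi ~ x^r e^(-S) phi_0 in the sense of Poincare, in every closed subsector
   |arg x| <= theta < 3 pi / m, locally uniformly in a. *)
Definition is_asymptotic_at_infinity (m : nat) (b : Tn m C -> nat -> C)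
    (Phi : C -> Tn m C -> C) : Prop :=
  exists phi : Tn m C -> nat -> C,
    (forall a, phi a 0%nat = 1) /\
    forall (a0 : Tn m C) (theta : R) (N : nat),
      (0 < theta < 3 * PI / INR m)%R ->
      exists delta K T : R, (0 < delta)%R /\
        forall (a : Tn m C) (t : C),
          (forall i : nat, (i < m)%nat ->
             Rlt (Cmod (coeff_Tn (RtoC 0) a i - coeff_Tn (RtoC 0) a0 i))
                 delta) ->
          (T <= Re t)%R -> (Rabs (Im t) <= theta)%R ->
          Rle (Cmod (cover_pow t (- r_exp m (b a)) * Cexp (S_exp m (b a) t)
                       * Phi t a
                     - sum_n (fun k => phi a k
                                * cover_pow t (- (INR k * series_step m))) N))
              (K * exp (- (INR (S N) * series_step m * Re t))).

Definition is_Phi0 (m : nat) (b : Tn m C -> nat -> C)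
    (Phi0 : C -> Tn m C -> C) : Prop :=
  (forall a, is_solution a (fun t => Phi0 t a)) /\
  is_asymptotic_at_infinity m b Phi0.

Definition Phi_ {m : nat} (Phi0 : C -> Tn m C -> C) (k : Z)
    (t : C) (a : Tn m C) : C :=
  Phi0 (rotate m k t) (weighted_scale (omega_pow m (IZR k)) a).

(* The parameter a = (a', a_m) with a_m = (p^2 - 1)/4, where m = n + 1. *)
Definition with_p {n : nat} (a' : Tn n C) (p : C) : Tn (S n) C :=
  mk_Tn (S n) (fun i => if Nat.ltb i n then coeff_Tn (RtoC 0) a' i
                        else (Cpow p 2 - 1) / 4).

Definition s (p : C) : C := (1 + p) / 2.

Definition admissible (p : C) : Prop :=
  forall k : nat, (1 <= k)%nat -> - p <> RtoC (INR k).

Definition is_Cinteger (p : C) : Prop := exists k : Z, p = RtoC (IZR k).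

Definition is_entire_expansion (c : nat -> C) (g : C -> C) : Prop :=
  forall x : C, is_pseries (K := C_AbsRing) (V := C_NormedModule) c x (g x).

Definition is_origin_system {n : nat} (f1 f2 : C -> Tn n C -> C -> C)
    : Prop :=
  exists (lambda : Tn n C -> C -> C) (g1 g2 : C -> Tn n C -> C -> C),
  forall (a' : Tn n C) (p : C), admissible p ->
    is_solution (with_p a' p) (fun t => f1 t a' p) /\
    is_solution (with_p a' p) (fun t => f2 t a' p) /\
    (forall c1 c2 : C,
       (forall t, c1 * f1 t a' p + c2 * f2 t a' p = 0) -> c1 = 0 /\ c2 = 0) /\
    (forall t, f1 t a' p = cover_pow t (s p) * g1 (Cexp t) a' p) /\
    (forall t, f2 t a' p = lambda a' p * f1 t a' p * t
                           + cover_pow t (s (- p)) * g2 (Cexp t) a' p) /\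
    (exists A : nat -> C,
       A 0%nat = 1 /\ is_entire_expansion A (fun x => g1 x a' p)) /\
    (exists B : nat -> C,
       is_entire_expansion B (fun x => g2 x a' p) /\
       (~ is_Cinteger p ->
          lambda a' p = 0 /\ forall x, g2 x a' p = g1 x a' (- p)) /\
       (forall k : nat, (1 <= k)%nat -> p = RtoC (INR k) ->
          B 0%nat = 1 /\ B k = 0) /\
       (p = 0 -> lambda a' p = 1 /\ g2 0 a' p = 0)).

(* Main.v *)
Require Import Defs.
From Stdlib Require Import Lra Lia Classical.

(** The relation [Phi_(-1) = C0 Phi_0 + C0t Phi_1] is read off twice: at infinity,
    where it gives [C0t], and at the origin, where it gives a linear relation between
    [C0], [C0t] and the values of [L0t] at [a'], [omega.a'] and [omega^2.a'].

    At infinity.  On the positive real axis [Phi_0] decays like [e^(-S)], while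
    [Phi_(-1)] and [Phi_1] both grow like [e^S], because the rotation
    [(x, a) -> (omega x, omega.a)] changes the sign of [S] ([S_exp_weighted_scale])
    and sends the exponent [r] to [1 - m/2 - r] ([r_exp_weighted_scale]).  Both facts
    rest on [b_(m/2 - k)(omega.a) = omega^k b_(m/2 - k)(a)], which is the uniqueness of
    the power series whose square is given ([sqrt_expansion_weighted_scale]).
    Dividing the relation by the growth of [Phi_(-1)] leaves
    [C0t = omega^(2 r - 2)] ([C0t_eq]).

    At the origin.  The Wronskian of two solutions, taken with respect to [x], is
    constant.  Taking the Wronskian with [f1] annihilates the [f1] component of a
    solution and multiplies its [f2] component by [W(f1, f2)], which is [-p], or [1]
    when [p = 0]: a nonzero number independent of [a'] ([wronskian_f1_f2]).  So this
    linear form extracts [L0t], in the resonant cases too, where [f2] has a logarithm.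
    It is compatible with rotation: [f1(omega x, omega.a')] and
    [omega^s(p) f1(x, a')] have the same Wronskians ([f1_rotate]).  Since [Phi_0] and
    [Phi_1] are the successive rotations of [Phi_(-1)], applying the linear form to
    the relation gives, with [q = omega^(1 - s(p))],
    [L0t(a') = C0 q L0t(omega.a') + C0t q^2 L0t(omega^2.a')] ([connection_relation]).

    The three formulas are this equality solved for [C0], with [omega^(m/2) = -1].
    For [m = 2], [omega^2 = 1] and [b_0 = a_1 / 2].  For [m = 1], [omega = 1], so the
    values of [L0t] cancel once [L0t <> 0] is known: otherwise all [Phi_k] would be
    multiples of [f1], but [Phi_0] decays on the positive axis where [Phi_1] grows
    ([L0t_neq_0]).  There [p] is only given up to sign, and one of [p], [-p] is
    admissible.

    Every analytic fact needed about a power series follows from its being Lipschitz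
    near the origin ([Cpseries_lipschitz]). *)

(** * Complex derivatives *)

Definition is_Cderive (f : C -> C) (t l : C) : Prop :=
  is_derive (K := C_AbsRing) (V := C_NormedModule) f t l.

Lemma is_Cderive_eps (f : C -> C) (t l : C) :
  is_Cderive f t l <->
  forall eps : R, (0 < eps)%R -> exists d : R, (0 < d)%R /\
    forall u : C, (Cmod u < d)%R ->
      Rle (Cmod (f (t + u) - f t - u * l)) (eps * Cmod u)%R.
Proof.
split.
- intros [_ H] eps He.
  destruct (H t (fun P HP => HP) (mkposreal eps He)) as [d Hd].
  exists d. split; [apply d|]. intros u Hu.
  specialize (Hd (t + u)).
  assert (B : ball (M := AbsRing_UniformSpace C_AbsRing) t d (t + u)).
  { unfold ball; simpl. unfold AbsRing_ball. unfold abs, minus, plus, opp; simpl.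
    replace (t + u + - t) with u by ring. exact Hu. }
  specialize (Hd B). simpl in Hd.
  unfold norm, minus, plus, opp, scal in Hd; simpl in Hd.
  unfold abs, mult, plus, opp in Hd; simpl in Hd.
  replace (t + u + - t) with u in Hd by ring.
  exact Hd.
- intros H. split.
  + apply is_linear_scal_l.
  + intros x Hx.
    assert (t = x) as <-.
    { apply (is_filter_lim_locally_unique (K := C_AbsRing) (V := AbsRing_NormedModule
      C_AbsRing)). exact Hx. }
    intros eps. destruct (H eps (cond_pos eps)) as [d [Hd K]].
    exists (mkposreal d Hd). intros y By.
    unfold ball in By; simpl in By. unfold AbsRing_ball in By. unfold abs, minus, plus, opp
      in By; simpl in By.
    specialize (K (y - t) By).
    assert (E : forall v w : C, v + (w - v) = w) by (intros; ring).
    rewrite E in K. exact K.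
Qed.

Lemma is_Cderive_eq f t l l' : is_Cderive f t l -> l = l' -> is_Cderive f t l'.
Proof. intros H <-. exact H. Qed.

Lemma is_Cderive_const (c t : C) : is_Cderive (fun _ => c) t 0.
Proof. exact (is_derive_const (K := C_AbsRing) (V := C_NormedModule) c t). Qed.

(** [C] carries two uniform structures, that of [R * R] and that of its modulus.  A
    derivative only involves the norm of the target, which is the modulus for both, so
    the rules for products and compositions can be borrowed from the second one. *)
Lemma is_Cderive_AbsRing (f : C -> C) (t l : C) :
  is_Cderive f t l <->
  is_derive (K := C_AbsRing) (V := AbsRing_NormedModule C_AbsRing) f t l.
Proof.
split; intros [_ H]; (split; [apply is_linear_scal_l | exact H]).
Qed.

Lemma is_Cderive_id (t : C) : is_Cderive (fun u => u) t 1.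
Proof. apply is_Cderive_AbsRing. exact (is_derive_id (K := C_AbsRing) t). Qed.

Lemma is_Cderive_plus (f g : C -> C) t l k : is_Cderive f t l -> is_Cderive g t k ->
  is_Cderive (fun u => f u + g u) t (l + k).
Proof. exact (is_derive_plus (K := C_AbsRing) (V := C_NormedModule) f g t l k). Qed.

Lemma is_Cderive_minus (f g : C -> C) t l k : is_Cderive f t l -> is_Cderive g t k ->
  is_Cderive (fun u => f u - g u) t (l - k).
Proof. exact (is_derive_minus (K := C_AbsRing) (V := C_NormedModule) f g t l k). Qed.

Lemma is_Cderive_mult (f g : C -> C) t l k : is_Cderive f t l -> is_Cderive g t k ->
  is_Cderive (fun u => f u * g u) t (l * g t + f t * k).
Proof. rewrite !is_Cderive_AbsRing. intros Hf Hg. exact (is_derive_mult (K := C_AbsRing) f g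
  t l k Hf Hg Cmult_comm). Qed.

Lemma is_Cderive_comp (f g : C -> C) t l k : is_Cderive f (g t) l -> is_Cderive g t k ->
  is_Cderive (fun u => f (g u)) t (k * l).
Proof. rewrite (is_Cderive_AbsRing g). exact (is_derive_comp (K := C_AbsRing) (V :=
  C_NormedModule) f g t l k). Qed.

Lemma is_Cderive_shift (f : C -> C) d t l : is_Cderive f (t + d) l ->
  is_Cderive (fun u => f (u + d)) t l.
Proof.
intros H. eapply is_Cderive_eq.
- apply is_Cderive_comp. exact H.
  apply is_Cderive_plus. apply is_Cderive_id. apply is_Cderive_const.
- ring.
Qed.

Lemma is_Cderive_ext (f g : C -> C) t l : (forall u, f u = g u) -> is_Cderive f t l ->
  is_Cderive g t l.
Proof. intros E H. exact (is_derive_ext (K := C_AbsRing) (V := C_NormedModule) f g t l E H).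
Qed.

Lemma is_Cderive_unique (f : C -> C) t l k : is_Cderive f t l -> is_Cderive f t k -> l = k.
Proof.
rewrite !is_Cderive_eps. intros H K.
destruct (Req_dec (Cmod (l - k)) 0) as [E|E].
{ apply Cmod_eq_0 in E. apply Ceq_minus. exact E. }
exfalso.
assert (P : (0 < Cmod (l - k)%C)%R) by (pose proof (Cmod_ge_0 (l - k)); lra).
destruct (H (Cmod (l - k)%C / 3)%R) as [d [Hd A]]; [lra|].
destruct (K (Cmod (l - k)%C / 3)%R) as [e [He B]]; [lra|].
set (h := (Rmin d e / 2)%R).
assert (Hh : (0 < h /\ h < d /\ h < e)%R).
{ unfold h. pose proof (Rmin_l d e). pose proof (Rmin_r d e).
  assert (0 < Rmin d e)%R by (apply Rmin_glb_lt; lra). lra. }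
assert (Mh : Cmod (RtoC h) = h) by (rewrite Cmod_R, Rabs_pos_eq; lra).
specialize (A h). specialize (B h). rewrite Mh in A, B.
assert (T : Rle (h * Cmod (l - k)%C)%R (Cmod (f (t + h) - f t - h * l)%C + Cmod (f (t + h) -
  f t - h * k)%C)%R).
{ rewrite <- Mh at 1. rewrite <- Cmod_mult.
  rewrite <- (Cmod_opp (f (t + h) - f t - h * l)).
  replace (h * (l - k)) with (- (f (t + h) - f t - h * l) + (f (t + h) - f t - h * k)) by ring.
  apply Cmod_triangle. }
assert (A' := A ltac:(lra)). assert (B' := B ltac:(lra)). nra.
Qed.

(** * The complex exponential *)

Lemma Cexp_plus z w : Cexp (z + w) = Cexp z * Cexp w.
Proof.
destruct z as [a b], w as [c d]. unfold Cexp, Cmult, Cplus; simpl.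
rewrite exp_plus, cos_plus, sin_plus. f_equal; ring.
Qed.

Lemma Cexp_0 : Cexp 0 = 1.
Proof. unfold Cexp; simpl. rewrite exp_0, cos_0, sin_0. unfold RtoC. f_equal; ring. Qed.

Lemma Cmod_Cexp z : Cmod (Cexp z) = exp (Re z).
Proof.
unfold Cexp, Cmod; simpl fst; simpl snd.
replace ((exp (Re z) * cos (Im z)) ^ 2 + (exp (Re z) * sin (Im z)) ^ 2)%R with (exp (Re z) ^
  2)%R.
- rewrite sqrt_pow2. reflexivity. left. apply exp_pos.
- pose proof (sin2_cos2 (Im z)) as H. unfold Rsqr in H.
  transitivity (exp (Re z) ^ 2 * (sin (Im z) * sin (Im z) + cos (Im z) * cos (Im z)))%R.
  rewrite H; ring. ring.
Qed.

Lemma Cexp_neq_0 z : Cexp z <> 0.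
Proof. intros H. pose proof (Cmod_Cexp z) as K. rewrite H, Cmod_0 in K. pose proof (exp_pos
  (Re z)). lra. Qed.

Lemma Cexp_opp z : Cexp (- z) = / Cexp z.
Proof.
pose proof (Cexp_plus z (- z)) as H. replace (z + - z) with (RtoC 0) in H by ring. rewrite
  Cexp_0 in H.
pose proof (Cexp_neq_0 z).
rewrite <- (Cmult_1_l (/ Cexp z)), H. field. assumption.
Qed.

Lemma Cexp_R (x : R) : Cexp x = exp x.
Proof. unfold Cexp; simpl. rewrite cos_0, sin_0. unfold RtoC. f_equal; ring. Qed.

Lemma Cexp_pow z k : Cpow (Cexp z) k = Cexp (INR k * z).
Proof.
induction k as [|k IH].
- simpl. rewrite Cmult_0_l, Cexp_0. reflexivity.
- rewrite Cpow_S, IH, <- Cexp_plus. f_equal. rewrite S_INR, RtoC_plus. ring.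
Qed.

Lemma Cexp_iR (y : R) : Cexp (Ci * y) = (cos y, sin y).
Proof. unfold Cexp, Ci; simpl. replace (0 * y - 1 * 0)%R with 0%R by ring. replace (0 * 0 + 1
  * y)%R with y by ring.
rewrite exp_0. f_equal; ring. Qed.

Lemma Cexp_2iPI : Cexp (2 * Ci * PI) = 1.
Proof.
replace (2 * Ci * PI) with (Ci * (RtoC (2 * PI))) by (rewrite RtoC_mult; ring).
rewrite Cexp_iR, cos_2PI, sin_2PI. reflexivity.
Qed.
Lemma Cexp_iPI : Cexp (Ci * PI) = - 1.
Proof.
rewrite Cexp_iR, cos_PI, sin_PI. unfold RtoC, Copp; simpl. f_equal; ring.
Qed.

Lemma Cmod_le_abs (z : C) : (Cmod z <= Rabs (Re z) + Rabs (Im z))%R.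
Proof.
destruct z as [x y]. simpl.
replace (x, y) with (RtoC x + Ci * RtoC y) by (unfold RtoC, Ci, Cmult, Cplus; simpl; f_equal;
  ring).
eapply Rle_trans. apply Cmod_triangle.
rewrite Cmod_mult, Cmod_Ci, !Cmod_R. lra.
Qed.

Lemma derivable_pt_lim_0_le (f : R -> R) (l eps : R) : derivable_pt_lim f 0 l -> (0 < eps)%R ->
  exists d : R, (0 < d)%R /\ forall h, (Rabs h < d)%R -> (Rabs (f h - f 0 - h * l) <= eps *
    Rabs h)%R.
Proof.
intros H He. destruct (H eps He) as [d Hd]. exists d. split. apply d.
intros h Hh. destruct (Req_dec h 0) as [->|N].
- rewrite Rmult_0_l, Rabs_R0. replace (f 0 - f 0 - 0)%R with 0%R by ring. rewrite Rabs_R0. lra.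
- specialize (Hd h N Hh). rewrite Rplus_0_l in Hd.
  replace (f h - f 0 - h * l)%R with (((f h - f 0) / h - l) * h)%R by (field; exact N).
  rewrite Rabs_mult. apply Rmult_le_compat_r. apply Rabs_pos. lra.
Qed.

(** With [u = x + i y], both components of [e^u - 1 - u] are combinations of
    [e^x - 1 - x], [cos y - 1] and [sin y - y], each of which is [o(u)]. *)
Lemma is_Cderive_Cexp_0 : is_Cderive Cexp 0 1.
Proof.
apply is_Cderive_eps. intros eps0 He0.
set (eps := Rmin (eps0 / 10) (1/2)).
assert (He : (0 < eps /\ eps <= 1/2 /\ 10 * eps <= eps0)%R).
{ unfold eps. pose proof (Rmin_l (eps0/10) (1/2)). pose proof (Rmin_r (eps0/10) (1/2)).
  assert (0 < Rmin (eps0/10) (1/2))%R by (apply Rmin_glb_lt; lra). lra. }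
clearbody eps. destruct He as [E1 [E2 E3]].
destruct (derivable_pt_lim_0_le exp 1 eps) as [d1 [D1 H1]]; [|exact E1|].
{ pose proof (derivable_pt_lim_exp 0) as Q. rewrite exp_0 in Q. exact Q. }
destruct (derivable_pt_lim_0_le cos 0 eps) as [d2 [D2 H2]]; [|exact E1|].
{ pose proof (derivable_pt_lim_cos 0) as Q. rewrite sin_0, Ropp_0 in Q. exact Q. }
destruct (derivable_pt_lim_0_le sin 1 eps) as [d3 [D3 H3]]; [|exact E1|].
{ pose proof (derivable_pt_lim_sin 0) as Q. rewrite cos_0 in Q. exact Q. }
rewrite exp_0 in H1. rewrite cos_0 in H2. rewrite sin_0 in H3.
exists (Rmin (Rmin d1 eps) (Rmin d2 d3)). split.
{ repeat apply Rmin_glb_lt; assumption. }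
intros u Hu. rewrite Cplus_0_l, Cexp_0.
assert (Hu1 := Rlt_le_trans _ _ _ Hu (Rmin_l _ _)).
assert (Hu2 := Rlt_le_trans _ _ _ Hu (Rmin_r _ _)).
assert (U1 := Rlt_le_trans _ _ _ Hu1 (Rmin_l _ _)).
assert (U2 := Rlt_le_trans _ _ _ Hu1 (Rmin_r _ _)).
assert (U3 := Rlt_le_trans _ _ _ Hu2 (Rmin_l _ _)).
assert (U4 := Rlt_le_trans _ _ _ Hu2 (Rmin_r _ _)).
clear Hu Hu1 Hu2.
pose proof (Rmax_Cmod u) as M.
assert (Mx := Rle_trans _ _ _ (Rmax_l _ _) M).
assert (My := Rle_trans _ _ _ (Rmax_r _ _) M).
destruct u as [x y]. simpl in Mx, My. clear M.
set (c := Cmod (x, y)) in *. clearbody c.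
specialize (H1 x ltac:(lra)). specialize (H2 y ltac:(lra)). specialize (H3 y ltac:(lra)).
eapply Rle_trans. apply Cmod_le_abs. unfold Cexp. simpl.
replace (exp x * cos y + - (1) + - (x * 1 - y * 0))%R with
  ((exp x - 1 - x * 1) * cos y + (1 + x) * (cos y - 1 - y * 0))%R by ring.
replace (exp x * sin y + - 0 + - (x * 0 + y * 1))%R with
  (exp x * (sin y - 0 - y * 1) + ((exp x - 1 - x * 1) + x) * y)%R by ring.
assert (Cy : (Rabs (cos y) <= 1)%R).
{ apply Rabs_le. apply COS_bound. }
assert (X1 : (Rabs (1 + x) <= 2)%R).
{ eapply Rle_trans. apply Rabs_triang. rewrite Rabs_R1. lra. }
assert (EX : (Rabs (exp x) <= 3)%R).
{ replace (exp x) with ((exp x - 1 - x * 1) + (1 + x))%R by ring.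
  eapply Rle_trans. apply Rabs_triang. pose proof (Rabs_pos x). nra. }
assert (EY : (Rabs (exp x - 1 - x * 1 + x) <= 2 * eps)%R).
{ eapply Rle_trans. apply Rabs_triang. pose proof (Rabs_pos x). nra. }
pose proof (Rabs_pos x) as Px. pose proof (Rabs_pos y) as Py.
assert (T1 : (Rabs ((exp x - 1 - x * 1) * cos y + (1 + x) * (cos y - 1 - y * 0)) <= eps * c *
  1 + 2 * (eps * c))%R).
{ eapply Rle_trans. apply Rabs_triang. rewrite !Rabs_mult.
  apply Rplus_le_compat; apply Rmult_le_compat; try apply Rabs_pos; try assumption.
  eapply Rle_trans. apply H1. nra. eapply Rle_trans. apply H2. nra. }
assert (T2 : (Rabs (exp x * (sin y - 0 - y * 1) + (exp x - 1 - x * 1 + x) * y) <= 3 * (eps *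
  c) + 2 * eps * c)%R).
{ eapply Rle_trans. apply Rabs_triang. rewrite !Rabs_mult.
  apply Rplus_le_compat; apply Rmult_le_compat; try apply Rabs_pos; try assumption.
  eapply Rle_trans. apply H3. nra. }
assert (0 <= c)%R by lra.
nra.
Qed.

Lemma is_Cderive_Cexp (t : C) : is_Cderive Cexp t (Cexp t).
Proof.
apply (is_Cderive_ext (fun u => Cexp t * Cexp (u + (- t)))).
{ intros u. rewrite <- Cexp_plus. f_equal. ring. }
eapply is_Cderive_eq.
- apply is_Cderive_mult. apply is_Cderive_const.
  apply is_Cderive_shift. replace (t + - t) with (RtoC 0) by ring. apply is_Cderive_Cexp_0.
- cbv beta. ring.
Qed.

(** On the segment from [x] to [y] the function of the real parameter has zero
    derivative. *)
Lemma is_Cderive_0_const (f : C -> C) : (forall t, is_Cderive f t 0) -> forall x y, f x = f y.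
Proof.
intros H x y.
set (phi := fun u : R => f (x + u * (y - x))).
replace (f x) with (phi 0%R) by (unfold phi; f_equal; ring).
replace (f y) with (phi 1%R) by (unfold phi; f_equal; ring).
apply (eq_is_derive (V := C_R_NormedModule) phi 0 1); [|lra].
intros u _. split. apply is_linear_scal_l.
intros v Hv.
assert (u = v) as <-.
{ apply (is_filter_lim_locally_unique (K := R_AbsRing) (V := R_NormedModule)). exact Hv. }
intros eps.
set (D := (Cmod (y - x) + 1)%R).
assert (HD : (0 < D)%R) by (unfold D; pose proof (Cmod_ge_0 (y - x)); lra).
destruct (proj1 (is_Cderive_eps _ _ _) (H (x + u * (y - x))) (eps / D)%R) as [d [Hd K]].
{ apply Rdiv_lt_0_compat. apply eps. exact HD. }
assert (Hd' : (0 < d / D)%R) by (apply Rdiv_lt_0_compat; assumption).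
exists (mkposreal _ Hd'). intros w Hw.
unfold ball in Hw; simpl in Hw. unfold AbsRing_ball in Hw. unfold abs, minus, plus, opp in
  Hw; simpl in Hw.
cbv beta.
match goal with |- context [minus _ (scal ?a ?z)] => set (sc := scal a z) end.
assert (Esc : sc = (RtoC 0)) by apply (scal_zero_r (V := C_R_NormedModule)).
rewrite Esc. clear sc Esc.
eapply Rle_trans. { right. exact (eq_sym (Cmod_norm (phi w - phi u - 0))). }
change (Rle (Cmod (phi w - phi u - 0)) (eps * Rabs (w + - u))).
replace (phi w - phi u - 0) with (phi w - phi u) by ring.
assert (Q : (D * Rabs (w + - u) < d)%R).
{ apply (Rmult_lt_compat_l D) in Hw; [|assumption].
  replace (D * (d / D))%R with d in Hw by (field; lra). exact Hw. }
assert (M : Rle (Cmod ((w + - u)%R * (y - x))) (D * Rabs (w + - u))).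
{ rewrite Cmod_mult, Cmod_R. rewrite Rmult_comm. apply Rmult_le_compat_r. apply Rabs_pos.
  unfold D. lra. }
specialize (K ((w + - u)%R * (y - x)) ltac:(lra)).
unfold phi. replace (x + w * (y - x)) with (x + u * (y - x) + (w + - u)%R * (y - x)) by
  (rewrite RtoC_plus, RtoC_opp; ring).
rewrite Cmult_0_r in K.
replace (f (x + u * (y - x) + (w + - u)%R * (y - x)) - f (x + u * (y - x)) - 0) with
 (f (x + u * (y - x) + (w + - u)%R * (y - x)) - f (x + u * (y - x))) in K by ring.
eapply Rle_trans. apply K.
replace (eps * Rabs (w + - u))%R with (eps / D * (D * Rabs (w + - u)))%R by (field; lra).
apply Rmult_le_compat_l; [|exact M]. left. apply Rdiv_lt_0_compat. apply eps. exact HD.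
Qed.

(** * Power series near the origin *)

Definition Cpseries (c : nat -> C) (x w : C) : Prop :=
  is_pseries (K := C_AbsRing) (V := C_NormedModule) c x w.

Fixpoint partial_sum (c : nat -> C) (x : C) (n : nat) : C :=
  match n with
  | O => c O
  | S k => partial_sum c x k + c (S k) * Cpow x (S k)
  end.

Lemma pow_n_Cpow (x : C) k : pow_n (K := C_Ring) x k = Cpow x k.
Proof. induction k; simpl; [reflexivity|]. rewrite IHk. reflexivity. Qed.

Lemma partial_sum_Cpow c x n :
  sum_n (G := C_AbelianMonoid) (fun k => Cpow x k * c k) n = partial_sum c x n.
Proof.
induction n as [|n IH].
- rewrite sum_O. simpl. ring.
- rewrite sum_Sn, IH. cbn [partial_sum]. unfold plus; cbn -[Cpow]. ring.
Qed.

Lemma partial_sum_pow_n c x :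
  forall n, sum_n (fun k : nat => scal (V := C_NormedModule) (pow_n (K := C_Ring) x k) (c k))
    n = partial_sum c x n.
Proof.
intros n. rewrite <- partial_sum_Cpow. apply sum_n_ext. intros k. rewrite pow_n_Cpow.
  reflexivity.
Qed.

Lemma Cpseries_eps c x w : Cpseries c x w <->
  forall eps : R, (0 < eps)%R -> exists N, forall n, (N <= n)%nat ->
    Rlt (Cmod (partial_sum c x n - w)) eps.
Proof.
unfold Cpseries, is_pseries, is_series.
rewrite (filterlim_locally_ball_norm (K := C_AbsRing) (U := C_NormedModule)).
split.
- intros H eps He. destruct (H (mkposreal eps He)) as [N HN]. exists N. intros n Hn.
  specialize (HN n Hn). unfold ball_norm in HN. rewrite partial_sum_pow_n in HN. exact HN.
- intros H eps. destruct (H eps (cond_pos eps)) as [N HN]. exists N. intros n Hn.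
  unfold ball_norm. rewrite partial_sum_pow_n. exact (HN n Hn).
Qed.

Lemma Cpseries_bounded c x w : Cpseries c x w ->
  exists M : R, (0 < M)%R /\ forall k, Rle (Cmod (c k) * Cmod x ^ k) M.
Proof.
intros H.
destruct (filterlim_bounded (K := C_AbsRing) (V := C_NormedModule) (partial_sum c x)) as [B HB].
{ exists w. apply (filterlim_locally_ball_norm (K := C_AbsRing) (U := C_NormedModule)).
  intros eps.
  destruct (proj1 (Cpseries_eps _ _ _) H eps (cond_pos eps)) as [N HN]. exists N. exact HN. }
change (forall n, Rle (Cmod (partial_sum c x n)) B) in HB.
assert (B0 : (0 <= B)%R) by (eapply Rle_trans; [apply Cmod_ge_0 | apply (HB O)]).
exists (2 * B + 1)%R. split; [lra|]. intros k. rewrite <- Cmod_pow, <- Cmod_mult.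
destruct k as [|k].
- specialize (HB O). simpl in HB. simpl. rewrite Cmult_1_r. lra.
- replace (c (S k) * Cpow x (S k)) with (partial_sum c x (S k) + - partial_sum c x k) by (cbn
  [partial_sum]; ring).
  eapply Rle_trans. apply Cmod_triangle. rewrite Cmod_opp. pose proof (HB k). pose proof (HB
    (S k)). lra.
Qed.

Lemma Cpow_diff_le (x y : C) (rho : R) k : (Cmod x <= rho)%R -> (Cmod y <= rho)%R ->
  Rle (rho * Cmod (Cpow x k - Cpow y k))%R (INR k * rho ^ k * Cmod (x - y)%C)%R.
Proof.
intros Hx Hy. assert (R0 : (0 <= rho)%R) by (pose proof (Cmod_ge_0 x); lra).
induction k as [|k IH].
- simpl. replace (1 - 1) with (RtoC 0) by ring. rewrite Cmod_0. lra.
- rewrite !Cpow_S. replace (x * Cpow x k - y * Cpow y k) with (x * (Cpow x k - Cpow y k) + (x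
  - y) * Cpow y k) by ring.
  eapply Rle_trans. apply Rmult_le_compat_l. exact R0. apply Cmod_triangle.
  rewrite !Cmod_mult, Cmod_pow, S_INR.
  assert (Cmod y ^ k <= rho ^ k)%R by (apply pow_incr; split; [apply Cmod_ge_0|exact Hy]).
  pose proof (Cmod_ge_0 (x - y)). pose proof (Cmod_ge_0 (Cpow x k - Cpow y k)).
  rewrite Rmult_plus_distr_l.
  replace ((INR k + 1) * rho ^ S k * Cmod (x - y)%C)%R with (rho * (INR k * rho ^ k * Cmod (x
    - y)%C) + rho * (Cmod (x - y)%C * rho ^ k))%R by (simpl; ring).
  apply Rplus_le_compat.
  + apply Rmult_le_compat_l; [exact R0|].
    eapply Rle_trans; [|apply IH]. apply Rmult_le_compat_r; assumption.
  + apply Rmult_le_compat_l; [exact R0|]. apply Rmult_le_compat_l; assumption.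
Qed.

Lemma INR_le_pow2 k : (INR k <= 2 ^ k)%R.
Proof.
induction k as [|k IH]. simpl; lra. rewrite S_INR. simpl.
pose proof (pow_R1_Rle 2 k). lra.
Qed.

(** If [|c_k| |z0|^k <= M], then on the disc of radius [rho = |z0| / 4] the [k]-th terms
    at [x] and [y] differ by at most [M (4 rho)^(-k) k rho^(k-1) |x - y|], and
    [k <= 2^k] makes these bounds a geometric series of ratio [1/2]. *)
Lemma Cpseries_lipschitz (c : nat -> C) (z0 w0 : C) : z0 <> 0 -> Cpseries c z0 w0 ->
  exists K : R, (0 < K)%R /\ forall x y gx gy : C,
    (Cmod x <= Cmod z0 / 4)%R -> (Cmod y <= Cmod z0 / 4)%R ->
    Cpseries c x gx -> Cpseries c y gy ->
    Rle (Cmod (gx - gy)) (K * Cmod (x - y)%C)%R.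
Proof.
intros Hz0 H. pose proof (proj1 (Cmod_gt_0 z0) Hz0) as Hz; clear Hz0.
destruct (Cpseries_bounded _ _ _ H) as [M [M0 HM]].
set (rho := (Cmod z0 / 4)%R).
assert (R0 : (0 < rho)%R) by (unfold rho; lra).
assert (Z : Cmod z0 = (4 * rho)%R) by (unfold rho; lra).
exists (2 * (M / rho))%R. split.
{ apply Rmult_lt_0_compat; [lra|]. apply Rdiv_lt_0_compat; assumption. }
intros x y gx gy Hx Hy Gx Gy. fold rho in Hx, Hy.
pose proof (Cmod_ge_0 (x - y)) as D0.
assert (T : forall k, Rle (Cmod (c k * (Cpow x k - Cpow y k))) (M / rho * Cmod (x - y)%C * (/
  2) ^ k)%R).
{ intros k. rewrite Cmod_mult.
  apply (Rmult_le_reg_l rho); [exact R0|].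
  apply (Rmult_le_reg_l (2 ^ k)); [apply pow_lt; lra|].
  replace (2 ^ k * (rho * (M / rho * Cmod (x - y)%C * (/ 2) ^ k)))%R with (M * Cmod (x -
    y)%C)%R.
  2: { rewrite pow_inv. field. split; [apply pow_nonzero|]; lra. }
  specialize (HM k). rewrite Z, Rpow_mult_distr in HM.
  pose proof (Cpow_diff_le x y rho k Hx Hy) as P.
  pose proof (INR_le_pow2 k) as I.
  assert (P2 : (0 < 2 ^ k)%R) by (apply pow_lt; lra).
  assert (Pr : (0 < rho ^ k)%R) by (apply pow_lt; lra).
  assert (P4 : (4 ^ k = 2 ^ k * 2 ^ k)%R) by (rewrite <- Rpow_mult_distr; f_equal; lra).
  pose proof (Cmod_ge_0 (c k)).
  apply Rle_trans with (2 ^ k * Cmod (c k) * (2 ^ k * rho ^ k * Cmod (x - y)%C))%R.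
  - replace (2 ^ k * (rho * (Cmod (c k) * Cmod (Cpow x k - Cpow y k))))%R with
      (2 ^ k * Cmod (c k) * (rho * Cmod (Cpow x k - Cpow y k)))%R by ring.
    apply Rmult_le_compat_l; [nra|]. eapply Rle_trans. exact P.
    apply Rmult_le_compat_r; [exact D0|]. apply Rmult_le_compat_r; lra.
  - replace (2 ^ k * Cmod (c k) * (2 ^ k * rho ^ k * Cmod (x - y)%C))%R with
      (Cmod (c k) * (4 ^ k * rho ^ k) * Cmod (x - y)%C)%R by (rewrite P4; ring).
    apply Rmult_le_compat_r; assumption. }
set (A := (M / rho * Cmod (x - y)%C)%R) in *.
assert (A0 : (0 <= A)%R).
{ apply Rmult_le_pos; [|exact D0]. left. apply Rdiv_lt_0_compat; assumption. }
assert (P : forall n, Rle (Cmod (partial_sum c x n - partial_sum c y n)) (A * (2 - (/ 2) ^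
  n))%R).
{ intros n. induction n as [|n IH].
  - simpl. replace (c O - c O) with (RtoC 0) by ring. rewrite Cmod_0. lra.
  - cbn [partial_sum].
    replace (partial_sum c x n + c (S n) * Cpow x (S n) - (partial_sum c y n + c (S n) * Cpow
      y (S n))) with
      ((partial_sum c x n - partial_sum c y n) + c (S n) * (Cpow x (S n) - Cpow y (S n))) by
        ring.
    eapply Rle_trans. apply Cmod_triangle.
    specialize (T (S n)). cbn [pow] in T |- *. nra. }
assert (Q : forall n, Rle (Cmod (partial_sum c x n - partial_sum c y n)) (2 * A)%R).
{ intros n. eapply Rle_trans. apply P. pose proof (pow_le (/ 2) n). nra. }
replace (2 * (M / rho) * Cmod (x - y)%C)%R with (2 * A)%R by (unfold A; ring).
apply Rle_plus_epsilon. intros eps He.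
destruct (proj1 (Cpseries_eps _ _ _) Gx (eps / 2)%R) as [N1 H1]; [lra|].
destruct (proj1 (Cpseries_eps _ _ _) Gy (eps / 2)%R) as [N2 H2]; [lra|].
set (n := Nat.max N1 N2).
specialize (H1 n ltac:(lia)). specialize (H2 n ltac:(lia)). specialize (Q n).
replace (gx - gy) with ((partial_sum c x n - partial_sum c y n) + (- (partial_sum c x n - gx)
  + (partial_sum c y n - gy))) by ring.
eapply Rle_trans. apply Cmod_triangle.
assert (Rle (Cmod (- (partial_sum c x n - gx) + (partial_sum c y n - gy))) (Cmod (partial_sum
  c x n - gx) + Cmod (partial_sum c y n - gy))%R).
{ rewrite <- (Cmod_opp (partial_sum c x n - gx)). apply Cmod_triangle. }
lra.
Qed.

Lemma Cpseries_0 c : Cpseries c 0 (c O).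
Proof. exact (is_pseries_0 (K := C_AbsRing) (V := C_NormedModule) c). Qed.

Lemma Cpseries_unique c x w w' : Cpseries c x w -> Cpseries c x w' -> w = w'.
Proof.
intros H H'. rewrite Cpseries_eps in H, H'.
apply Ceq_minus. apply Cmod_eq_0. apply Rle_antisym; [|apply Cmod_ge_0].
apply Rle_plus_epsilon. intros eps He.
destruct (H (eps / 2)%R) as [N1 H1]; [lra|].
destruct (H' (eps / 2)%R) as [N2 H2]; [lra|].
set (n := Nat.max N1 N2).
specialize (H1 n ltac:(lia)). specialize (H2 n ltac:(lia)).
replace (w - w') with (- (partial_sum c x n - w) + (partial_sum c x n - w')) by ring.
eapply Rle_trans. apply Cmod_triangle. rewrite Cmod_opp. lra.
Qed.

(** * Limits of complex functions along a filter *)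

Definition Clim {T : Type} (D : (T -> Prop) -> Prop) (F : T -> C) (l : C) : Prop :=
  forall eps : R, (0 < eps)%R -> D (fun x => Rlt (Cmod (F x - l)) eps).

Section Limits.
Context {T : Type} (D : (T -> Prop) -> Prop) {FD : Filter D}.

Lemma Clim_ext_loc (F G : T -> C) l : D (fun x => F x = G x) -> Clim D F l -> Clim D G l.
Proof.
intros E H eps He. generalize (filter_and _ _ E (H eps He)). apply filter_imp.
intros x [<- Hx]. exact Hx.
Qed.

Lemma Clim_ext (F G : T -> C) l : (forall x, F x = G x) -> Clim D F l -> Clim D G l.
Proof. intros E. apply Clim_ext_loc. apply filter_forall. exact E. Qed.

Lemma Clim_eq (F : T -> C) l k : Clim D F l -> l = k -> Clim D F k.
Proof. intros H <-. exact H. Qed.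

Lemma Clim_const c : Clim D (fun _ => c) c.
Proof.
intros eps He. apply filter_forall. intros _.
replace (c - c) with (RtoC 0) by ring. rewrite Cmod_0. exact He.
Qed.

Lemma Clim_plus F G l k : Clim D F l -> Clim D G k -> Clim D (fun x => F x + G x) (l + k).
Proof.
intros H K eps He.
assert (E2 : (0 < eps / 2)%R) by lra.
generalize (filter_and _ _ (H (eps / 2)%R E2) (K (eps / 2)%R E2)).
apply filter_imp. intros x [A B].
replace (F x + G x - (l + k)) with ((F x - l) + (G x - k)) by ring.
eapply Rle_lt_trans. apply Cmod_triangle. lra.
Qed.

Lemma Clim_mult F G l k : Clim D F l -> Clim D G k -> Clim D (fun x => F x * G x) (l * k).
Proof.
intros H K eps He.
set (B := (Cmod l + Cmod k + 1)%R).
assert (HB : (0 < B)%R) by (unfold B; pose proof (Cmod_ge_0 l); pose proof (Cmod_ge_0 k); lra).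
set (e := Rmin 1 (eps / (2 * B))).
assert (Hq : (0 < eps / (2 * B))%R) by (apply Rdiv_lt_0_compat; lra).
assert (He1 : (0 < e)%R) by (apply Rmin_glb_lt; lra).
assert (He2 : (e <= 1)%R) by apply Rmin_l.
assert (He3 : (2 * (e * B) <= eps)%R).
{ pose proof (Rmin_r 1 (eps / (2 * B))) as Q. fold e in Q.
  apply (Rmult_le_compat_r (2 * B)) in Q; [|lra].
  replace (eps / (2 * B) * (2 * B))%R with eps in Q by (field; lra). lra. }
generalize (filter_and _ _ (H e He1) (K e He1)).
apply filter_imp. intros x [A1 A2].
replace (F x * G x - l * k) with ((F x - l) * (G x - k) + (l * (G x - k) + (F x - l) * k)) by
  ring.
eapply Rle_lt_trans. apply Cmod_triangle.
eapply Rle_lt_trans. apply Rplus_le_compat_l. apply Cmod_triangle.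
rewrite !Cmod_mult.
pose proof (Cmod_ge_0 (F x - l)). pose proof (Cmod_ge_0 (G x - k)).
pose proof (Cmod_ge_0 l). pose proof (Cmod_ge_0 k).
assert (Rle (Cmod (F x - l) * Cmod (G x - k)) (e * 1)) by (apply Rmult_le_compat; lra).
assert (Rle (Cmod l * Cmod (G x - k)) (Cmod l * e)) by (apply Rmult_le_compat; lra).
assert (Rle (Cmod (F x - l) * Cmod k) (e * Cmod k)) by (apply Rmult_le_compat; lra).
unfold B in *. nra.
Qed.

Lemma Clim_0_mult_bounded F G M : Clim D F 0 -> D (fun x => Rle (Cmod (G x)) M) ->
  Clim D (fun x => F x * G x) 0.
Proof.
intros H K eps He.
set (B := (Rabs M + 1)%R).
assert (HB : (0 < B)%R) by (unfold B; pose proof (Rabs_pos M); lra).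
assert (Hq : (0 < eps / B)%R) by (apply Rdiv_lt_0_compat; lra).
generalize (filter_and _ _ (H _ Hq) K). apply filter_imp. intros x [A1 A2].
replace (F x - 0) with (F x) in A1 by ring. replace (F x * G x - 0) with (F x * G x) by ring.
rewrite Cmod_mult.
apply Rle_lt_trans with (Cmod (F x) * B)%R.
{ apply Rmult_le_compat_l. apply Cmod_ge_0. pose proof (Rle_abs M). unfold B. lra. }
apply (Rmult_lt_compat_r B) in A1; [|exact HB].
replace (eps / B * B)%R with eps in A1 by (field; lra). exact A1.
Qed.
End Limits.

Lemma Clim_unique {T} (D : (T -> Prop) -> Prop) {PD : ProperFilter D} F l k : Clim D F l ->
  Clim D F k -> l = k.
Proof.
intros H K. apply Ceq_minus. apply Cmod_eq_0. apply Rle_antisym; [|apply Cmod_ge_0].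
apply Rle_plus_epsilon. intros eps He.
assert (E2 : (0 < eps / 2)%R) by lra.
destruct (filter_ex _ (filter_and _ _ (H (eps / 2)%R E2) (K (eps / 2)%R E2))) as [x [A B]].
replace (l - k) with (- (F x - l) + (F x - k)) by ring.
eapply Rle_trans. apply Cmod_triangle. rewrite Cmod_opp. lra.
Qed.

(** * Wronskians *)

Lemma is_x_derive_unique F F1 F2 : is_x_derive F F1 -> is_x_derive F F2 -> forall t, F1 t =
  F2 t.
Proof.
intros H K t. pose proof (is_Cderive_unique _ _ _ _ (H t) (K t)) as E.
pose proof (Cexp_neq_0 t) as N.
replace (F1 t) with (/ Cexp t * (Cexp t * F1 t)) by (field; exact N).
rewrite E. field. exact N.
Qed.

Lemma is_x_derive_lin F F' G G' c d : is_x_derive F F' -> is_x_derive G G' ->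
  is_x_derive (fun t => c * F t + d * G t) (fun t => c * F' t + d * G' t).
Proof.
intros H K t. eapply is_Cderive_eq.
- apply is_Cderive_plus; (apply is_Cderive_mult; [apply is_Cderive_const|]). apply H. apply K.
- cbv beta. ring.
Qed.

Lemma is_x_derive_shift F F' d : is_x_derive F F' ->
  is_x_derive (fun t => F (t + d)) (fun t => Cexp d * F' (t + d)).
Proof.
intros H t. eapply is_Cderive_eq. apply is_Cderive_shift. apply H. rewrite Cexp_plus. ring.
Qed.

Lemma is_x_derive_ext F G F' : (forall t, F t = G t) -> is_x_derive F F' -> is_x_derive G F'.
Proof. intros E H t. apply (is_Cderive_ext F). exact E. apply H. Qed.

(** Solutions come without a chosen derivative, so the Wronskian is a relation; it is
    functional by [is_wronskian_unique]. *)
Definition is_wronskian (F G : C -> C) (w : C) : Prop :=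
  exists F' G' : C -> C, is_x_derive F F' /\ is_x_derive G G' /\
    forall t, F t * G' t - F' t * G t = w.

Lemma is_wronskian_unique F G w v : is_wronskian F G w -> is_wronskian F G v -> w = v.
Proof.
intros (F1 & G1 & HF1 & HG1 & H1) (F2 & G2 & HF2 & HG2 & H2).
rewrite <- (H1 0), <- (H2 0).
rewrite (is_x_derive_unique _ _ _ HF1 HF2 0), (is_x_derive_unique _ _ _ HG1 HG2 0). reflexivity.
Qed.

Lemma is_wronskian_self F F' : is_x_derive F F' -> is_wronskian F F 0.
Proof. intros H. exists F', F'. split; [exact H|split; [exact H|]]. intros t. ring. Qed.

Lemma is_wronskian_lin F G H c d w v : is_wronskian F G w -> is_wronskian F H v ->
  is_wronskian F (fun t => c * G t + d * H t) (c * w + d * v).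
Proof.
intros (F1 & G1 & HF1 & HG1 & H1) (F2 & H2 & HF2 & HH2 & K2).
exists F1, (fun t => c * G1 t + d * H2 t). split; [exact HF1|]. split; [apply
  is_x_derive_lin; assumption|].
intros t. rewrite <- (H1 t), <- (K2 t), (is_x_derive_unique _ _ _ HF2 HF1 t). ring.
Qed.

Lemma is_wronskian_ext F G K w : (forall t, G t = K t) -> is_wronskian F G w -> is_wronskian
  F K w.
Proof.
intros E (F1 & G1 & HF1 & HG1 & H1). exists F1, G1. split; [exact HF1|].
split; [exact (is_x_derive_ext _ _ _ E HG1)|]. intros t. rewrite <- E. apply H1.
Qed.

Lemma is_wronskian_shift F G w d : is_wronskian F G w ->
  is_wronskian (fun t => F (t + d)) (fun t => G (t + d)) (Cexp d * w).
Proof.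
intros (F1 & G1 & HF1 & HG1 & H1).
exists (fun t => Cexp d * F1 (t + d)), (fun t => Cexp d * G1 (t + d)).
repeat (split; [apply is_x_derive_shift; assumption|]).
intros t. rewrite <- (H1 (t + d)). ring.
Qed.

Lemma is_wronskian_exists {m} (a : Tn m C) F G : is_solution a F -> is_solution a G ->
  exists w, is_wronskian F G w.
Proof.
intros (F' & HF & HF2) (G' & HG & HG2).
exists (F 0 * G' 0 - F' 0 * G 0), F', G'. split; [exact HF|split; [exact HG|]].
intros t. apply (is_Cderive_0_const (fun t => F t * G' t - F' t * G t)).
intros u. eapply is_Cderive_eq.
- apply is_Cderive_minus; apply is_Cderive_mult. apply HF. apply HG2. apply HF2. apply HG.
- cbv beta. ring.
Qed.

Lemma is_solution_ext {m} (a : Tn m C) F G : (forall t, F t = G t) -> is_solution a F ->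
  is_solution a G.
Proof.
intros E (F' & HF & HF2). exists F'. split. exact (is_x_derive_ext _ _ _ E HF).
intros t. rewrite <- E. apply HF2.
Qed.

(** * Rotation of the variable and of the parameters *)

Lemma coeff_mk_Tn {A} (x0 : A) n (u : nat -> A) i : (i < n)%nat -> coeff_Tn x0 (mk_Tn n u) i
  = u i.
Proof.
intros Hi. exact (proj2 (mk_Tn_ext n (coeff_Tn x0 (mk_Tn n u)) u) (mk_Tn_bij x0 (mk_Tn n u))
  i Hi).
Qed.

Lemma coef_weighted_scale {m} (tau : C) (a : Tn m C) k : (k <= m)%nat ->
  coef (weighted_scale tau a) k = Cpow tau k * coef a k.
Proof.
intros Hk. destruct k as [|k]; cbn [coef].
- simpl. ring.
- unfold weighted_scale. rewrite coeff_mk_Tn by lia. reflexivity.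
Qed.

Lemma P_weighted_scale {m} (tau : C) (a : Tn m C) x : Cpow tau m = 1 ->
  P (weighted_scale tau a) (tau * x) = P a x.
Proof.
intros Ht. unfold P. apply sum_n_ext_loc. intros k Hk.
rewrite coef_weighted_scale by exact Hk. rewrite Cpow_mult_l.
replace (Cpow tau k * coef a k * (Cpow tau (m - k) * Cpow x (m - k))) with
  (Cpow tau k * Cpow tau (m - k) * (coef a k * Cpow x (m - k))) by ring.
rewrite <- Cpow_add_r. replace (k + (m - k))%nat with m by lia. rewrite Ht. apply Cmult_1_l.
Qed.

(** [P] is invariant under [(x, a) -> (tau x, tau.a)] when [tau^m = 1], and the operator
    [x^2 d^2/dx^2] is invariant under [x -> tau x]. *)
Lemma is_solution_shift {m} (a : Tn m C) d F : Cpow (Cexp d) m = 1 ->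
  is_solution (weighted_scale (Cexp d) a) F -> is_solution a (fun t => F (t + d)).
Proof.
intros Hd (F' & HF & HF2). exists (fun t => Cexp d * F' (t + d)). split.
- apply is_x_derive_shift. exact HF.
- intros t. eapply is_Cderive_eq.
  + apply is_Cderive_mult. apply is_Cderive_const. apply is_Cderive_shift. apply HF2.
  + cbv beta. rewrite Cexp_plus, (Cmult_comm (Cexp t) (Cexp d)).
    rewrite P_weighted_scale by exact Hd. pose proof (Cexp_neq_0 t). pose proof (Cexp_neq_0 d).
    field. split; assumption.
Qed.

(** * Solutions of Frobenius type at the origin *)

Definition lipschitz_near_0 (g : C -> C) : Prop :=
  exists rho K : R, (0 < rho)%R /\ (0 < K)%R /\ forall x y : C,
    (Cmod x <= rho)%R -> (Cmod y <= rho)%R -> Rle (Cmod (g x - g y)) (K * Cmod (x - y)%C)%R.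

Lemma entire_expansion_lipschitz c g : is_entire_expansion c g -> lipschitz_near_0 g.
Proof.
intros H.
destruct (Cpseries_lipschitz c 1 (g 1)) as [K [K0 HK]]; [apply C1_nz | apply H|].
exists (/ 4)%R, K. split; [lra|]. split; [exact K0|]. intros x y Hx Hy.
rewrite Cmod_1 in HK. apply HK; try lra; apply H.
Qed.

Lemma entire_expansion_0 c g : is_entire_expansion c g -> g 0 = c O.
Proof. intros H. apply (Cpseries_unique c 0). apply H. apply Cpseries_0. Qed.

Lemma lipschitz_near_0_scale g kappa tau : Cmod tau = 1%R -> lipschitz_near_0 g ->
  lipschitz_near_0 (fun x => kappa * g (tau * x)).
Proof.
intros Ht (rho & K & R0 & K0 & H).
exists rho, (K * (Cmod kappa + 1))%R. split; [exact R0|].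
pose proof (Cmod_ge_0 kappa) as Hk. split; [nra|].
intros x y Hx Hy.
replace (kappa * g (tau * x) - kappa * g (tau * y)) with (kappa * (g (tau * x) - g (tau *
  y))) by ring.
rewrite Cmod_mult.
specialize (H (tau * x) (tau * y)). rewrite !Cmod_mult, Ht, !Rmult_1_l in H.
specialize (H Hx Hy). replace (tau * x - tau * y) with (tau * (x - y)) in H by ring.
rewrite Cmod_mult, Ht, Rmult_1_l in H.
pose proof (Cmod_ge_0 (x - y)). pose proof (Cmod_ge_0 (g (tau * x) - g (tau * y))).
assert (0 <= K * Cmod (x - y)%C)%R by nra. nra.
Qed.

Lemma exp_small (eps : R) : (0 < eps)%R -> exists M : R, forall x : R, (x < M)%R -> (exp x <
  eps)%R.
Proof.
intros He. exists (ln eps). intros x Hx. rewrite <- (exp_ln eps He). apply exp_increasing.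
  exact Hx.
Qed.

Lemma Clim_lipschitz g : lipschitz_near_0 g ->
  Clim (Rbar_locally m_infty) (fun x : R => g (Cexp x)) (g 0).
Proof.
intros (rho & K & R0 & K0 & H) eps He.
set (e := Rmin rho (eps / (2 * K))).
assert (Hq : (0 < eps / (2 * K))%R) by (apply Rdiv_lt_0_compat; lra).
assert (He' : (0 < e)%R) by (apply Rmin_glb_lt; assumption).
destruct (exp_small e He') as [M HM]. exists M. intros x Hx.
specialize (HM x Hx).
assert (E1 : (e <= rho)%R) by apply Rmin_l. assert (E2 : (e <= eps / (2 * K))%R) by apply
  Rmin_r.
assert (M0 : Cmod (Cexp x) = exp x) by (rewrite Cmod_Cexp; reflexivity).
specialize (H (Cexp x) 0). rewrite M0, Cmod_0 in H. specialize (H ltac:(lra) ltac:(lra)).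
replace (Cexp x - 0) with (Cexp x) in H by ring. rewrite M0 in H.
eapply Rle_lt_trans. exact H.
assert (K * exp x <= K * (eps / (2 * K)))%R by (apply Rmult_le_compat_l; lra).
replace (K * (eps / (2 * K)))%R with (eps / 2)%R in H0 by (field; lra). lra.
Qed.

(** A Lipschitz bound on [g] bounds the derivative of [g(e^t)], by the difference
    quotient along a real step.  The step is negative, so that [e^t] stays in the disc
    where the Lipschitz bound holds. *)
Lemma lipschitz_derive_bound (g : C -> C) (rho K : R) (t G : C) :
  (0 < K)%R ->
  (forall x y : C, (Cmod x <= rho)%R -> (Cmod y <= rho)%R -> Rle (Cmod (g x - g y)) (K * Cmod
    (x - y)%C)%R) ->
  is_Cderive (fun u => g (Cexp u)) t G -> (Cmod (Cexp t) <= rho)%R ->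
  (Cmod G <= K * Cmod (Cexp t))%R.
Proof.
intros K0 HL HG Ht. apply Rle_plus_epsilon. intros eps He.
pose proof (is_Cderive_Cexp t) as HE. rewrite is_Cderive_eps in HG, HE.
assert (Hq : (0 < eps / (2 * K))%R) by (apply Rdiv_lt_0_compat; lra).
destruct (HG (eps / 2)%R) as [d1 [D1 H1]]; [lra|].
destruct (HE (eps / (2 * K))%R Hq) as [d2 [D2 H2]].
set (h := (Rmin d1 d2 / 2)%R).
assert (Hm : (0 < Rmin d1 d2)%R) by (apply Rmin_glb_lt; assumption).
assert (Hh : (0 < h /\ h < d1 /\ h < d2)%R).
{ unfold h. pose proof (Rmin_l d1 d2). pose proof (Rmin_r d1 d2). lra. }
clearbody h. destruct Hh as [h0 [h1 h2]].
assert (Mh : Cmod (RtoC (- h)) = h) by (rewrite Cmod_R, Rabs_Ropp, Rabs_pos_eq; lra).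
specialize (H1 (RtoC (- h))). specialize (H2 (RtoC (- h))). rewrite Mh in H1, H2.
specialize (H1 h1). specialize (H2 h2).
assert (HL' := HL (Cexp (t + (- h)%R)) (Cexp t)).
assert (Q : (Cmod (Cexp (t + (- h)%R)) <= rho)%R).
{ eapply Rle_trans; [|exact Ht]. rewrite !Cmod_Cexp. left. apply exp_increasing. destruct t.
  simpl. lra. }
specialize (HL' Q Ht).
assert (A : Rle (Cmod ((- h)%R * G)) (Cmod (g (Cexp (t + (- h)%R)) - g (Cexp t)) + eps / 2 *
  h)%R).
{ replace ((- h)%R * G) with ((g (Cexp (t + (- h)%R)) - g (Cexp t)) + - (g (Cexp (t + (-
  h)%R)) - g (Cexp t) - (- h)%R * G)) by ring.
  eapply Rle_trans. apply Cmod_triangle. rewrite Cmod_opp. apply Rplus_le_compat_l. exact H1. }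
assert (B : Rle (Cmod (Cexp (t + (- h)%R) - Cexp t)) (h * Cmod (Cexp t) + eps / (2 * K) * h)%R).
{ replace (Cexp (t + (- h)%R) - Cexp t) with ((- h)%R * Cexp t + (Cexp (t + (- h)%R) - Cexp t
  - (- h)%R * Cexp t)) by ring.
  eapply Rle_trans. apply Cmod_triangle. rewrite Cmod_mult, Mh. apply Rplus_le_compat_l.
    exact H2. }
rewrite Cmod_mult, Mh in A.
apply (Rmult_le_reg_l h); [exact h0|].
assert (E : (K * (h * Cmod (Cexp t) + eps / (2 * K) * h) = h * (K * Cmod (Cexp t)) + eps / 2
  * h)%R) by (field; lra).
assert (K * Cmod (Cexp (t + (- h)%R) - Cexp t)%C <= K * (h * Cmod (Cexp t) + eps / (2 * K) *
  h))%R
  by (apply Rmult_le_compat_l; lra).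
lra.
Qed.

Lemma Clim_lipschitz_derive g (G : C -> C) : lipschitz_near_0 g ->
  (forall t, is_Cderive (fun u => g (Cexp u)) t (G t)) ->
  Clim (Rbar_locally m_infty) (fun x : R => G x) 0.
Proof.
intros (rho & K & R0 & K0 & H) HG eps He.
assert (Hq : (0 < eps / K)%R) by (apply Rdiv_lt_0_compat; lra).
set (e := Rmin rho (eps / K)).
assert (He' : (0 < e)%R) by (apply Rmin_glb_lt; assumption).
destruct (exp_small e He') as [M HM]. exists M. intros x Hx. specialize (HM x Hx).
assert (E1 : (e <= rho)%R) by apply Rmin_l. assert (E2 : (e <= eps / K)%R) by apply Rmin_r.
assert (M0 : Cmod (Cexp x) = exp x) by (rewrite Cmod_Cexp; reflexivity).
assert (B := lipschitz_derive_bound g rho K x (G x) K0 H (HG x)). rewrite M0 in B.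
specialize (B ltac:(lra)).
replace (G x - 0) with (G x) by ring. eapply Rle_lt_trans. exact B.
apply Rlt_le_trans with (K * (eps / K))%R. apply Rmult_lt_compat_l; lra. right. field. lra.
Qed.

Lemma cover_pow_plus t p q : cover_pow t (p + q) = cover_pow t p * cover_pow t q.
Proof. unfold cover_pow. rewrite <- Cexp_plus. f_equal. ring. Qed.

Lemma cover_pow_shift t d p : cover_pow (t + d) p = cover_pow t p * cover_pow d p.
Proof. unfold cover_pow. rewrite <- Cexp_plus. f_equal. ring. Qed.

Lemma cover_pow_0 t : cover_pow t 0 = 1.
Proof. unfold cover_pow. rewrite Cmult_0_l. apply Cexp_0. Qed.

Lemma cover_pow_1 t : cover_pow t 1 = Cexp t.
Proof. unfold cover_pow. rewrite Cmult_1_l. reflexivity. Qed.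

Lemma is_Cderive_cover_pow t p : is_Cderive (fun u => cover_pow u p) t (p * cover_pow t p).
Proof.
unfold cover_pow. eapply is_Cderive_eq.
- apply (is_Cderive_comp Cexp (fun u => p * u)). apply is_Cderive_Cexp.
  apply is_Cderive_mult. apply is_Cderive_const. apply is_Cderive_id.
- cbv beta. ring.
Qed.

Lemma frobenius_derive sigma g f f' :
  (forall t, f t = cover_pow t sigma * g (Cexp t)) -> is_x_derive f f' ->
  exists G : C -> C, (forall t, is_Cderive (fun u => g (Cexp u)) t (G t)) /\
    forall t, Cexp t * f' t = cover_pow t sigma * (sigma * g (Cexp t) + G t).
Proof.
intros Hf H.
assert (Hinv : forall t, cover_pow t sigma * cover_pow t (- sigma) = 1).
{ intros t. rewrite <- cover_pow_plus. replace (sigma + - sigma) with (RtoC 0) by ring. apply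
  cover_pow_0. }
exists (fun t => cover_pow t (- sigma) * (Cexp t * f' t) - sigma * g (Cexp t)). split.
- intros t. apply (is_Cderive_ext (fun u => cover_pow u (- sigma) * f u)).
  { intros u. rewrite Hf. replace (cover_pow u (- sigma) * (cover_pow u sigma * g (Cexp u)))
    with
      (cover_pow u sigma * cover_pow u (- sigma) * g (Cexp u)) by ring. rewrite Hinv. ring. }
  eapply is_Cderive_eq.
  + apply is_Cderive_mult. apply is_Cderive_cover_pow. apply H.
  + cbv beta. rewrite Hf.
    replace (- sigma * cover_pow t (- sigma) * (cover_pow t sigma * g (Cexp t))) with
     (- sigma * (cover_pow t sigma * cover_pow t (- sigma)) * g (Cexp t)) by ring. rewrite
       Hinv. ring.
- intros t.
  replace (cover_pow t sigma * (sigma * g (Cexp t) + (cover_pow t (- sigma) * (Cexp t * f' t)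
    - sigma * g (Cexp t)))) with
   (cover_pow t sigma * cover_pow t (- sigma) * (Cexp t * f' t)) by ring.
  rewrite Hinv. ring.
Qed.

(** The behaviour at the origin of the Wronskian of [x^sigma g] and [x^tau h]: the terms
    containing [x g'] or [x h'] vanish in the limit. *)
Lemma frobenius_wronskian (sigma tau : C) (g h f F f' F' : C -> C) :
  (forall t, f t = cover_pow t sigma * g (Cexp t)) -> is_x_derive f f' -> lipschitz_near_0 g ->
  (forall t, F t = cover_pow t tau * h (Cexp t)) -> is_x_derive F F' -> lipschitz_near_0 h ->
  exists V : C -> C, Clim (Rbar_locally m_infty) (fun x : R => V x) ((tau - sigma) * (g 0 * h
    0)) /\
    forall t, f t * F' t - f' t * F t = cover_pow t (sigma + tau - 1) * V t.
Proof.
intros Hf Df Lg HF DF Lh.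
destruct (frobenius_derive _ _ _ _ Hf Df) as [G [HG EG]].
destruct (frobenius_derive _ _ _ _ HF DF) as [H [HH EH]].
exists (fun t => (tau - sigma) * (g (Cexp t) * h (Cexp t)) + (g (Cexp t) * H t + (- (1)) * (G
  t * h (Cexp t)))). split.
- eapply Clim_eq.
  + apply Clim_plus. apply Rbar_locally_filter.
    * apply Clim_mult. apply Rbar_locally_filter. apply Clim_const; apply Rbar_locally_filter.
      apply Clim_mult. apply Rbar_locally_filter. apply Clim_lipschitz, Lg. apply
        Clim_lipschitz, Lh.
    * apply Clim_plus. apply Rbar_locally_filter.
      -- apply Clim_mult. apply Rbar_locally_filter. apply Clim_lipschitz, Lg. apply
        (Clim_lipschitz_derive h); assumption.
      -- apply Clim_mult. apply Rbar_locally_filter. apply Clim_const; apply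
        Rbar_locally_filter.
         apply Clim_mult. apply Rbar_locally_filter. apply (Clim_lipschitz_derive g);
           assumption. apply Clim_lipschitz, Lh.
  + ring.
- intros t. pose proof (Cexp_neq_0 t) as N.
  assert (E : Cexp t * (f t * F' t - f' t * F t) = cover_pow t (sigma + tau) *
    ((tau - sigma) * (g (Cexp t) * h (Cexp t)) + (g (Cexp t) * H t + (- (1)) * (G t * h (Cexp
      t))))).
  { replace (Cexp t * (f t * F' t - f' t * F t)) with (f t * (Cexp t * F' t) - (Cexp t * f'
    t) * F t) by ring.
    rewrite EG, EH, Hf, HF, cover_pow_plus. ring. }
  replace (sigma + tau) with ((sigma + tau - 1) + 1) in E by ring.
  rewrite (cover_pow_plus _ _ 1), cover_pow_1 in E.
  apply (f_equal (fun z => / Cexp t * z)) in E.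
  match type of E with ?l = ?r =>
    replace l with (f t * F' t - f' t * F t) in E by (field; exact N) end.
  rewrite E. field. exact N.
Qed.

Lemma Cexp_2iPI_mult_eq_1 p : Cexp (2 * Ci * PI * p) = 1 -> is_Cinteger p.
Proof.
intros H. destruct p as [x y].
assert (E : 2 * Ci * PI * (x, y) = ((- (2 * PI * y))%R, (2 * (PI * x))%R)).
{ unfold Ci, Cmult, RtoC; simpl. f_equal; ring. }
rewrite E in H. pose proof (f_equal Cmod H) as M. rewrite Cmod_Cexp, Cmod_1 in M. simpl in M.
assert (Hy : y = 0%R).
{ rewrite <- exp_0 in M. apply exp_inv in M. pose proof PI_RGT_0. nra. }
unfold Cexp in H. simpl in H. subst y.
apply (f_equal fst) in H. simpl in H. rewrite cos_2a_sin, !Rmult_0_r, Ropp_0, exp_0 in H.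
assert (Hs : sin (PI * x) = 0%R) by nra.
destruct (sin_eq_0_0 _ Hs) as [k Hk]. exists k. unfold RtoC. f_equal.
pose proof PI_RGT_0. apply (Rmult_eq_reg_l PI); lra.
Qed.

Lemma admissible_integer p : admissible p -> is_Cinteger p -> exists k : nat, p = INR k.
Proof.
intros Ha [k ->]. exists (Z.to_nat k). f_equal. rewrite INR_IZR_INZ.
destruct (Z_le_gt_dec 0 k) as [L|L]. { rewrite Z2Nat.id by exact L. reflexivity. }
exfalso. apply (Ha (Z.to_nat (- k))). lia.
rewrite <- RtoC_opp, INR_IZR_INZ, Z2Nat.id by lia. rewrite opp_IZR. reflexivity.
Qed.

(** The constant [w] equals [x^p V] with [V -> 0] at the origin.  When [p] is an integer
    it is nonnegative by admissibility, so [x^p] is bounded and [w = 0]; otherwise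
    [w = 0] by monodromy. *)
Lemma frobenius_proportional {m} (a : Tn m C) (p : C) (f F g h : C -> C) :
  admissible p -> is_solution a f -> is_solution a F ->
  (forall t, f t = cover_pow t (s p) * g (Cexp t)) -> lipschitz_near_0 g ->
  (forall t, F t = cover_pow t (s p) * h (Cexp t)) -> lipschitz_near_0 h ->
  is_wronskian f F 0.
Proof.
intros Ap Sf SF Hf Lg HF Lh.
destruct (is_wronskian_exists a f F Sf SF) as [w (f' & F' & Df & DF & HW)].
exists f', F'. split; [exact Df|]. split; [exact DF|]. intros t0. rewrite HW. clear t0.
assert (Es : s p + s p - 1 = p) by (unfold s; field).
destruct (frobenius_wronskian (s p) (s p) g h f F f' F' Hf Df Lg HF DF Lh) as [V [LV EV]].
rewrite Es in EV.
destruct (classic (is_Cinteger p)) as [Ip|Np].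
- destruct (admissible_integer p Ap Ip) as [k Hk].
  apply (Clim_unique (Rbar_locally m_infty) (fun _ : R => w)).
  { apply Clim_const. apply Rbar_locally_filter. }
  apply (Clim_ext _ (fun x : R => V x * cover_pow x p)).
  { intros x. rewrite <- (HW x), EV. ring. }
  apply (Clim_0_mult_bounded _ _ _ 1%R).
  { eapply Clim_eq. exact LV. ring. }
  exists 0%R. intros x Hx. unfold cover_pow. rewrite Cmod_Cexp, Hk.
  replace (Re (INR k * x)) with (INR k * x)%R by (rewrite <- RtoC_mult; reflexivity).
  rewrite <- exp_0. pose proof (pos_INR k).
  destruct (Req_dec (INR k * x) 0) as [->|N0]; [lra|]. left. apply exp_increasing. nra.
(* Continuation around the origin, x -> e^(2 i pi) x, multiplies both solutions
   by e^(2 i pi s(p)), hence w by e^(2 i pi (1 + p)), which differs from 1. *)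
- set (T := 2 * Ci * PI).
  assert (ET : Cexp T = 1) by apply Cexp_2iPI.
  assert (Per : forall H H' e, is_x_derive H H' -> (forall t, H t = cover_pow t (s p) * e
    (Cexp t)) ->
    (forall t, H (t + T) = cover_pow T (s p) * H t) /\ forall t, H' (t + T) = cover_pow T (s
      p) * H' t).
  { intros H H' e DH EH.
    assert (E1 : forall t, H (t + T) = cover_pow T (s p) * H t).
    { intros t. rewrite !EH, cover_pow_shift, Cexp_plus, ET, Cmult_1_r. ring. }
    split; [exact E1|]. intros t.
    pose proof (is_x_derive_shift _ _ T DH) as D1.
    pose proof (is_x_derive_lin _ _ _ _ (cover_pow T (s p)) 0 DH DH) as D2.
    apply (is_x_derive_ext _ (fun t => H (t + T))) in D2.
    2: { intros u. rewrite E1. ring. }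
    pose proof (is_x_derive_unique _ _ _ D1 D2 t) as U. cbv beta in U. rewrite ET in U.
    rewrite Cmult_1_l in U. rewrite U. ring. }
  destruct (Per f f' g Df Hf) as [P1 P2]. destruct (Per F F' h DF HF) as [P3 P4].
  pose proof (HW (0 + T)) as W1. rewrite P1, P2, P3, P4 in W1.
  assert (E : cover_pow T (s p) * cover_pow T (s p) * w = w).
  { rewrite <- W1 at 2. rewrite <- (HW 0). ring. }
  rewrite <- cover_pow_plus in E. replace (s p + s p) with (1 + p) in E by (unfold s; field).
  rewrite cover_pow_plus, cover_pow_1, ET in E.
  assert (E' : (cover_pow T p - 1) * w = 0). { rewrite <- (Cplus_opp_r w). rewrite <- E at 2.
    ring. }
  destruct (classic (w = 0)) as [W0|W0]; [exact W0|]. exfalso.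
  apply (Cmult_neq_0 (cover_pow T p - 1) w); [|exact W0|exact E'].
  intros Q. apply Np. apply Cexp_2iPI_mult_eq_1. apply Ceq_minus in Q. unfold cover_pow in Q.
  rewrite <- Q. f_equal. unfold T. ring.
Qed.

(** From the identity [f W(F, Phi) - F W(f, Phi) + Phi W(f, F) = 0], whose last term
    vanishes: [W(F, Phi) / W(f, Phi) = F / f], and this is [h(0) / g(0)] at the origin.
    It spares the proof that [F] is a multiple of [f]. *)
Lemma frobenius_wronskian_ratio {m} (a : Tn m C) (p : C) (f F g h Phi : C -> C) c :
  admissible p -> is_solution a f -> is_solution a F ->
  (forall t, f t = cover_pow t (s p) * g (Cexp t)) -> lipschitz_near_0 g ->
  (forall t, F t = cover_pow t (s p) * h (Cexp t)) -> lipschitz_near_0 h ->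
  g 0 = 1 -> is_solution a Phi -> is_wronskian f Phi c -> is_wronskian F Phi (h 0 * c).
Proof.
intros Ap Sf SF Hf Lg HF Lh G0 SP WP.
pose proof (frobenius_proportional a p f F g h Ap Sf SF Hf Lg HF Lh) as W0.
destruct (is_wronskian_exists a F Phi SF SP) as [w Ww].
replace (h 0 * c) with w; [exact Ww|].
destruct W0 as (f1 & F1 & Df1 & DF1 & E0).
destruct Ww as (F2 & P2 & DF2 & DP2 & E1).
destruct WP as (f3 & P3 & Df3 & DP3 & E2).
apply (Clim_unique (Rbar_locally m_infty) (fun x : R => g (Cexp x) * w)).
- eapply Clim_eq. apply Clim_mult. apply Rbar_locally_filter. apply Clim_lipschitz, Lg.
  apply Clim_const, Rbar_locally_filter. rewrite G0. ring.
- apply (Clim_ext _ (fun x : R => h (Cexp x) * c)).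
  + intros x.
    assert (Q : cover_pow x (s p) <> 0) by apply Cexp_neq_0.
    assert (E : f x * w = F x * c).
    { rewrite <- (E1 x), <- (E2 x).
      rewrite (is_x_derive_unique _ _ _ DF2 DF1 x), (is_x_derive_unique _ _ _ Df3 Df1 x),
        (is_x_derive_unique _ _ _ DP3 DP2 x).
      apply Ceq_minus.
      replace (f x * (F x * P2 x - F1 x * Phi x) - F x * (f x * P2 x - f1 x * Phi x)) with
        (- (f x * F1 x - f1 x * F x) * Phi x) by ring.
      rewrite (E0 x). ring. }
    rewrite Hf, HF in E.
    replace (h (Cexp x) * c) with (/ cover_pow x (s p) * (cover_pow x (s p) * h (Cexp x) *
      c)) by (field; exact Q).
    rewrite <- E. field. exact Q.
  + apply Clim_mult. apply Rbar_locally_filter. apply Clim_lipschitz, Lh. apply Clim_const,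
    Rbar_locally_filter.
Qed.

(** * The fundamental system at the origin *)

Lemma admissible_opp_nonint p : ~ is_Cinteger p -> admissible (- p).
Proof.
intros H k _ E. apply H. exists (Z.of_nat k). rewrite <- INR_IZR_INZ, <- E. ring.
Qed.

Lemma Clim_cover_pow_minfty (k : nat) : (1 <= k)%nat ->
  Clim (Rbar_locally m_infty) (fun x : R => cover_pow x (INR k)) 0.
Proof.
intros Hk eps He. destruct (exp_small eps He) as [M HM]. exists (Rmin M 0). intros x Hx.
pose proof (Rmin_l M 0). pose proof (Rmin_r M 0).
replace (cover_pow x (INR k) - 0) with (cover_pow x (INR k)) by ring.
unfold cover_pow. rewrite <- RtoC_mult, Cmod_Cexp. simpl.
eapply Rle_lt_trans; [|apply (HM x); lra].
pose proof (le_INR 1 k Hk). simpl in H1.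
destruct (Req_dec (INR k * x) x) as [->|N]; [lra|]. left. apply exp_increasing. nra.
Qed.

Definition origin_wronskian (p w : C) : Prop := (p = 0 -> w = 1) /\ (p <> 0 -> w = - p).

Lemma origin_wronskian_neq_0 p w : origin_wronskian p w -> w <> 0.
Proof.
intros [H0 H1] E. destruct (classic (p = 0)) as [Z|Z].
- apply C1_nz. rewrite <- (H0 Z). exact E.
- apply Z. replace p with (- - p) by ring. rewrite <- (H1 Z), E. ring.
Qed.

Section Origin.
Context {n : nat} (f1 f2 : C -> Tn n C -> C -> C) (Hf : is_origin_system f1 f2).

Lemma f1_solution a' p : admissible p -> is_solution (with_p a' p) (fun t => f1 t a' p).
Proof. destruct Hf as (l & g1 & g2 & H). intros Ap. apply (H a' p Ap). Qed.

Lemma f1_frobenius a' p : admissible p -> exists g,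
  lipschitz_near_0 g /\ g 0 = 1 /\ forall t, f1 t a' p = cover_pow t (s p) * g (Cexp t).
Proof.
destruct Hf as (l & g1 & g2 & H). intros Ap.
destruct (H a' p Ap) as (_ & _ & _ & E1 & _ & (A & A0 & HA) & _).
exists (fun x => g1 x a' p). split; [exact (entire_expansion_lipschitz _ _ HA)|].
split; [rewrite (entire_expansion_0 _ _ HA); exact A0|]. exact E1.
Qed.

(** After removal of its logarithm [f2] is of Frobenius type with exponent [s(-p)], so
    the Wronskian is [-p g1 g2 + lambda x^p g1^2] up to terms vanishing at the origin.
    The normalisation of [f2] determines the limit in each case: [lambda = 0] and
    [g2(0) = 1] when [p] is not an integer, [x^p -> 0] and [g2(0) = 1] when [p] is a
    positive integer, [lambda = 1] and [g2(0) = 0] when [p = 0]. *)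
Lemma wronskian_f1_f2 p : admissible p -> exists w, origin_wronskian p w /\
  forall a', is_wronskian (fun t => f1 t a' p) (fun t => f2 t a' p) w.
Proof.
intros Ap.
assert (Ex : exists w, origin_wronskian p w).
{ destruct (classic (p = 0)) as [Z|Z]; [exists 1 | exists (- p)]; split; intros Q; easy. }
destruct Ex as [w Hw]. exists w. split; [exact Hw|]. intros a'.
destruct Hf as (lam & g1 & g2 & H).
destruct (H a' p Ap) as (S1 & S2 & _ & E1 & E2 & (A & A0 & HA) & (B & HB & Bnon & Bpos &
  Bzero)).
pose proof (entire_expansion_lipschitz _ _ HA) as L1.
pose proof (entire_expansion_lipschitz _ _ HB) as L2.
pose proof (entire_expansion_0 _ _ HA) as G1. rewrite A0 in G1.
pose proof (entire_expansion_0 _ _ HB) as G2.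
destruct (is_wronskian_exists _ _ _ S1 S2) as [v Wv].
replace w with v; [exact Wv|].
destruct Wv as (f1' & f2' & D1 & D2 & Ev).
set (F := fun t => f2 t a' p - lam a' p * f1 t a' p * t).
set (F' := fun t => f2' t - (lam a' p * f1' t * t + lam a' p * f1 t a' p / Cexp t)).
assert (DF : is_x_derive F F').
{ intros t. eapply is_Cderive_eq.
  - apply is_Cderive_minus. apply D2. apply is_Cderive_mult.
    apply is_Cderive_mult. apply is_Cderive_const. apply D1. apply is_Cderive_id.
  - unfold F'. cbv beta. field. apply Cexp_neq_0. }
destruct (frobenius_wronskian (s p) (s (- p)) _ _ _ _ _ _ E1 D1 L1
   (fun t => ltac:(unfold F; rewrite E2; ring) : F t = cover_pow t (s (- p)) * g2 (Cexp t) a'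
     p) DF L2)
  as [V [LV EV]].
assert (EL : forall x : R, v = V x + lam a' p * (cover_pow x p * (g1 (Cexp x) a' p * g1 (Cexp
  x) a' p))).
{ intros x. specialize (EV x). rewrite <- (Ev x).
  replace (s p + s (- p) - 1) with (RtoC 0) in EV by (unfold s; field).
  rewrite cover_pow_0, Cmult_1_l in EV. rewrite <- EV. unfold F, F'.
  assert (E : cover_pow x p * (g1 (Cexp x) a' p * g1 (Cexp x) a' p) = f1 x a' p * f1 x a' p /
    Cexp x).
  { rewrite E1. rewrite <- (cover_pow_1 x).
    replace (cover_pow x (s p) * g1 (cover_pow x 1) a' p * (cover_pow x (s p) * g1 (cover_pow
      x 1) a' p)) with
     (cover_pow x (s p) * cover_pow x (s p) * (g1 (cover_pow x 1) a' p * g1 (cover_pow x 1)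
       a' p)) by ring.
    rewrite <- cover_pow_plus. replace (s p + s p) with (p + 1) by (unfold s; field).
    rewrite cover_pow_plus. field. rewrite cover_pow_1. apply Cexp_neq_0. }
  rewrite E. field. apply Cexp_neq_0. }
assert (Es : s (- p) - s p = - p) by (unfold s; field).
cbv beta in LV. rewrite Es, G1, G2 in LV.
assert (Lg : Clim (Rbar_locally m_infty) (fun x : R => g1 (Cexp x) a' p) 1).
{ rewrite <- G1. exact (Clim_lipschitz _ L1). }
assert (Key : forall l, Clim (Rbar_locally m_infty) (fun x : R => lam a' p * cover_pow x p) l ->
   v = - p * B O + l).
{ intros l Hl. apply (Clim_unique (Rbar_locally m_infty) (fun _ : R => v)).
  { apply Clim_const, Rbar_locally_filter. }
  apply (Clim_ext _ (fun x : R => V x + (lam a' p * cover_pow x p) * (g1 (Cexp x) a' p * g1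
    (Cexp x) a' p))).
  { intros x. rewrite (EL x). ring. }
  eapply Clim_eq. apply Clim_plus. apply Rbar_locally_filter. exact LV.
  apply Clim_mult. apply Rbar_locally_filter. exact Hl.
  apply Clim_mult. apply Rbar_locally_filter. exact Lg. exact Lg. ring. }
destruct Hw as [W0 W1].
destruct (classic (is_Cinteger p)) as [Ip|Np].
- destruct (admissible_integer p Ap Ip) as [[|k] Hk].
  + simpl in Hk. rewrite (W0 Hk). destruct (Bzero Hk) as [Bl _].
    rewrite (Key 1). rewrite Hk; ring.
    apply (Clim_ext _ (fun _ : R => 1)). intros x. rewrite Bl, Hk, cover_pow_0. ring.
    apply Clim_const, Rbar_locally_filter.
  + destruct (Bpos (S k) ltac:(lia) Hk) as [B0 _].
    rewrite W1. 2: { rewrite Hk. intros Q. apply RtoC_inj in Q. apply (not_0_INR (S k));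
      [lia|exact Q]. }
    rewrite (Key 0). rewrite B0. ring.
    apply (Clim_ext _ (fun x : R => lam a' p * cover_pow x (INR (S k)))). { intros x. rewrite
      <- Hk. reflexivity. }
    eapply Clim_eq. apply Clim_mult. apply Rbar_locally_filter.
    apply Clim_const, Rbar_locally_filter. apply Clim_cover_pow_minfty. lia. ring.
- destruct (Bnon Np) as [Bl Bg].
  rewrite W1. 2: { intros Q. apply Np. exists 0%Z. exact Q. }
  assert (B0 : B O = 1).
  { rewrite <- G2, Bg. destruct (H a' (- p) (admissible_opp_nonint p Np)) as (_ & _ & _ & _ &
    _ & (A' & A0' & HA') & _).
    rewrite (entire_expansion_0 _ _ HA'). exact A0'. }
  rewrite (Key 0). rewrite B0. ring.
  apply (Clim_ext _ (fun _ : R => 0)). intros x. rewrite Bl. ring.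
  apply Clim_const, Rbar_locally_filter.
Qed.

Lemma weighted_scale_with_p (tau : C) (a' : Tn n C) p : Cpow tau (S n) = 1 ->
  weighted_scale tau (with_p a' p) = with_p (weighted_scale tau a') p.
Proof.
intros Ht. unfold weighted_scale at 1. unfold with_p at 2. apply mk_Tn_ext. intros i Hi.
unfold with_p. rewrite coeff_mk_Tn by exact Hi.
destruct (Nat.ltb i n) eqn:E.
- apply Nat.ltb_lt in E. unfold weighted_scale. rewrite coeff_mk_Tn by exact E. reflexivity.
- apply Nat.ltb_ge in E. replace (S i) with (S n) by lia. rewrite Ht. ring.
Qed.

(** The rotation of [f1(., e^d.a')] by [d] solves the same equation as [f1(., a')] and is
    of Frobenius type with the same exponent and leading coefficient [e^(d s(p))].  The
    remaining factor [e^d] comes from [d/dx]. *)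
Lemma f1_rotate a' p d Phi c : admissible p -> Re d = 0%R -> Cpow (Cexp d) (S n) = 1 ->
  is_solution (with_p (weighted_scale (Cexp d) a') p) Phi ->
  is_wronskian (fun t => f1 t (weighted_scale (Cexp d) a') p) Phi c ->
  is_solution (with_p a' p) (fun t => Phi (t + d)) /\
  is_wronskian (fun t => f1 t a' p) (fun t => Phi (t + d)) (cover_pow d (1 - s p) * c).
Proof.
intros Ap Rd Hd SP WP.
set (b' := weighted_scale (Cexp d) a') in *.
unfold b' in SP. rewrite <- (weighted_scale_with_p _ _ _ Hd) in SP.
pose proof (is_solution_shift _ _ _ Hd SP) as SP'. split; [exact SP'|].
pose proof (f1_solution b' p Ap) as SF. unfold b' in SF. rewrite <- (weighted_scale_with_p _
  _ _ Hd) in SF.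
pose proof (is_solution_shift _ _ _ Hd SF) as SF'. fold b' in SF'. cbv beta in SF'.
pose proof (is_wronskian_shift _ _ _ d WP) as WP'. cbv beta in WP'.
destruct (is_wronskian_exists _ _ _ (f1_solution a' p Ap) SP') as [w Hw].
replace (cover_pow d (1 - s p) * c) with w; [exact Hw|].
destruct (f1_frobenius a' p Ap) as (g & Lg & G0 & Eg).
destruct (f1_frobenius b' p Ap) as (h & Lh & H0 & Eh).
assert (Md : Cmod (Cexp d) = 1%R) by (rewrite Cmod_Cexp, Rd; apply exp_0).
pose proof (frobenius_wronskian_ratio (with_p a' p) p _ (fun t => f1 (t + d) b' p) g
   (fun x => cover_pow d (s p) * h (Cexp d * x)) _ w Ap (f1_solution a' p Ap) SF' Eg Lg
   (fun t => ltac:(rewrite Eh, cover_pow_shift, Cexp_plus, (Cmult_comm (Cexp t)); ring) :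
      f1 (t + d) b' p = cover_pow t (s p) * (cover_pow d (s p) * h (Cexp d * Cexp t)))
   (lipschitz_near_0_scale h _ _ Md Lh) G0 SP' Hw) as W.
cbv beta in W. rewrite Cmult_0_r, H0 in W.
pose proof (is_wronskian_unique _ _ _ _ W WP') as E.
replace (1 - s p) with (1 + - s p) by ring. rewrite cover_pow_plus, cover_pow_1.
replace (Cexp d * cover_pow d (- s p) * c) with (cover_pow d (- s p) * (Cexp d * c)) by ring.
rewrite <- E.
replace (cover_pow d (- s p) * (cover_pow d (s p) * 1 * w)) with (cover_pow d (- s p) *
  cover_pow d (s p) * w) by ring.
rewrite <- cover_pow_plus. replace (- s p + s p) with (RtoC 0) by ring. rewrite cover_pow_0.
  ring.
Qed.
End Origin.

(** * Connection with the origin *)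

Definition arg_step (m : nat) : C := 2 * Ci * PI / INR m.

Lemma RtoC_INR_S_neq_0 n : RtoC (INR (S n)) <> 0.
Proof. intros H. apply RtoC_inj in H. apply (not_0_INR (S n)); [lia|exact H]. Qed.

Lemma rotate_arg_step n k t : rotate (S n) k t = t + IZR k * arg_step (S n).
Proof. unfold rotate, arg_step. field. apply RtoC_INR_S_neq_0. Qed.

Lemma omega_pow_arg_step n c : omega_pow (S n) c = Cexp (c * arg_step (S n)).
Proof. unfold omega_pow, arg_step. f_equal. field. apply RtoC_INR_S_neq_0. Qed.

Lemma Cexp_full_turn n (k : Z) : Cpow (Cexp (IZR k * arg_step (S n))) (S n) = 1.
Proof.
rewrite Cexp_pow.
replace (INR (S n) * (IZR k * arg_step (S n))) with (IZR k * (2 * Ci * PI)) by (unfold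
  arg_step; field; apply RtoC_INR_S_neq_0).
assert (P : forall j : nat, Cexp (INR j * (2 * Ci * PI)) = 1).
{ intros j. rewrite <- Cexp_pow, Cexp_2iPI. apply Cpow_1_l. }
destruct (Z_le_gt_dec 0 k) as [L|L].
- rewrite <- (Z2Nat.id k) by exact L. rewrite <- INR_IZR_INZ. apply P.
- replace (IZR k * (2 * Ci * PI)) with (- (INR (Z.to_nat (- k)) * (2 * Ci * PI))).
  + rewrite Cexp_opp, P. field.
  + rewrite INR_IZR_INZ, Z2Nat.id by lia. rewrite opp_IZR, RtoC_opp. ring.
Qed.

Lemma Re_arg_step n : Re (arg_step (S n)) = 0%R.
Proof.
unfold arg_step. replace (2 * Ci * PI / INR (S n)) with (Ci * RtoC (2 * PI / INR (S n))%R).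
- unfold Ci, RtoC, Cmult; simpl. ring.
- rewrite RtoC_div, RtoC_mult. field. apply RtoC_INR_S_neq_0. apply not_0_INR. lia.
Qed.

Lemma weighted_scale_weighted_scale {m} (tau sig : C) (a : Tn m C) :
  weighted_scale tau (weighted_scale sig a) = weighted_scale (tau * sig) a.
Proof.
unfold weighted_scale at 1 3. apply mk_Tn_ext. intros i Hi. unfold weighted_scale. rewrite
  coeff_mk_Tn by exact Hi.
rewrite Cpow_mult_l. ring.
Qed.

Lemma weighted_scale_1 {m} (a : Tn m C) : weighted_scale 1 a = a.
Proof.
unfold weighted_scale. etransitivity; [|apply (mk_Tn_bij (RtoC 0) a)]. apply mk_Tn_ext.
  intros i Hi.
rewrite Cpow_1_l. ring.
Qed.

Lemma Phi_rotate {n} (Phi0 : C -> Tn (S n) C -> C) (k j : Z) t (a : Tn (S n) C) :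
  Phi_ Phi0 k (t + IZR j * arg_step (S n)) (weighted_scale (Cexp (IZR j * arg_step (S n))) a)
  = Phi_ Phi0 (k + j) t a.
Proof.
unfold Phi_. f_equal.
- rewrite !rotate_arg_step, plus_IZR, RtoC_plus. ring.
- rewrite weighted_scale_weighted_scale, !omega_pow_arg_step, <- Cexp_plus, plus_IZR, RtoC_plus.
  f_equal. f_equal. ring.
Qed.

Lemma Phi_0 {n} (Phi0 : C -> Tn (S n) C -> C) t (a : Tn (S n) C) : Phi_ Phi0 0 t a = Phi0 t a.
Proof.
unfold Phi_. f_equal.
- rewrite rotate_arg_step. ring.
- rewrite omega_pow_arg_step, Cmult_0_l, Cexp_0. apply weighted_scale_1.
Qed.

Lemma Phi_solution {n} (Phi0 : C -> Tn (S n) C -> C) k (a : Tn (S n) C) :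
  (forall a, is_solution a (fun t => Phi0 t a)) -> is_solution a (fun t => Phi_ Phi0 k t a).
Proof.
intros H. unfold Phi_.
apply (is_solution_ext _ (fun t => Phi0 (t + IZR k * arg_step (S n)) (weighted_scale
  (omega_pow (S n) (IZR k)) a))).
{ intros t. rewrite rotate_arg_step. reflexivity. }
apply (is_solution_shift a (IZR k * arg_step (S n))
   (fun t => Phi0 t (weighted_scale (omega_pow (S n) (IZR k)) a))).
- apply Cexp_full_turn.
- rewrite omega_pow_arg_step. apply H.
Qed.

(** The Wronskian with [f1(., a')] is applied to both sides of the relation defining
    [C0] and [C0t]: [Phi_0] and [Phi_1] at [a] are [Phi_(-1)] at [omega.a] and
    [omega^2.a], rotated once and twice. *)
Theorem connection_relation (n : nat) (Phi0 : C -> Tn (S n) C -> C) (C0 C0t : Tn (S n) C -> C)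
  (f1 f2 : C -> Tn n C -> C -> C) (L0 L0t : Tn n C -> C -> C)
  (SPhi0 : forall a, is_solution a (fun t => Phi0 t a))
  (HC0 : forall a t, Phi_ Phi0 (-1) t a = C0 a * Phi0 t a + C0t a * Phi_ Phi0 1 t a)
  (Hf : is_origin_system f1 f2)
  (HL0 : forall a' p, admissible p -> forall t,
     Phi_ Phi0 (-1) t (with_p a' p) = L0 a' p * f1 t a' p + L0t a' p * f2 t a' p)
  (a' : Tn n C) (p : C) : admissible p ->
  let omega := omega_pow (S n) 1 in
  let q := omega_pow (S n) (1 - s p) in
  L0t a' p = C0 (with_p a' p) * (q * L0t (weighted_scale omega a') p)
    + C0t (with_p a' p) * (q * (q * L0t (weighted_scale (Cpow omega 2) a') p)).
Proof.
intros Ap omega q.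
set (d := 1%R * arg_step (S n)).
assert (Hd : Cpow (Cexp d) (S n) = 1) by apply (Cexp_full_turn n 1).
assert (Rd : Re d = 0%R) by (unfold d; rewrite Cmult_1_l; apply Re_arg_step).
assert (Eo : omega = Cexp d) by (unfold omega; rewrite omega_pow_arg_step; reflexivity).
assert (Eq : q = cover_pow d (1 - s p)).
{ unfold q. rewrite omega_pow_arg_step. unfold cover_pow, d. f_equal. ring. }
clearbody q. subst q. rewrite Eo. clear omega Eo.
replace (weighted_scale (Cpow (Cexp d) 2) a') with (weighted_scale (Cexp d) (weighted_scale
  (Cexp d) a')).
2: { rewrite weighted_scale_weighted_scale. f_equal. simpl. ring. }
destruct (wronskian_f1_f2 f1 f2 Hf p Ap) as [w [Hw W12]].
pose proof (origin_wronskian_neq_0 p w Hw) as w0.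
set (Psi := fun b' t => Phi_ Phi0 (-1) t (with_p b' p)).
assert (WPsi : forall b', is_wronskian (fun t => f1 t b' p) (Psi b') (L0t b' p * w)).
{ intros b'. apply (is_wronskian_ext _ (fun t => L0 b' p * f1 t b' p + L0t b' p * f2 t b' p)).
  { intros t. symmetry. apply HL0. exact Ap. }
  destruct (f1_solution f1 f2 Hf b' p Ap) as (f1' & D1 & _).
  pose proof (is_wronskian_lin _ _ _ (L0 b' p) (L0t b' p) _ _ (is_wronskian_self _ _ D1) (W12
    b')) as W.
  replace (L0t b' p * w) with (L0 b' p * 0 + L0t b' p * w) by ring. exact W. }
assert (SPsi : forall b', is_solution (with_p b' p) (Psi b')).
{ intros b'. apply Phi_solution. exact SPhi0. }
set (b1 := weighted_scale (Cexp d) a'). set (b2 := weighted_scale (Cexp d) b1).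
destruct (f1_rotate f1 f2 Hf a' p d (Psi b1) _ Ap Rd Hd (SPsi b1) (WPsi b1)) as [_ W1].
destruct (f1_rotate f1 f2 Hf b1 p d (Psi b2) _ Ap Rd Hd (SPsi b2) (WPsi b2)) as [S2 W2].
destruct (f1_rotate f1 f2 Hf a' p d _ _ Ap Rd Hd S2 W2) as [_ W3].
cbv beta in W3.
pose proof (is_wronskian_lin _ _ _ (C0 (with_p a' p)) (C0t (with_p a' p)) _ _ W1 W3) as W.
apply (is_wronskian_ext _ _ (Psi a')) in W.
2: { intros t. unfold Psi. rewrite (HC0 (with_p a' p) t). unfold b2, b1.
  rewrite <- !(weighted_scale_with_p _ _ _ Hd). unfold d.
  rewrite !Phi_rotate. change (-1 + 1 + 1)%Z with 1%Z. change (-1 + 1)%Z with 0%Z. rewrite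
    Phi_0. reflexivity. }
pose proof (is_wronskian_unique _ _ _ _ W (WPsi a')) as E.
replace (L0t a' p) with (L0t a' p * w / w) by (field; exact w0).
rewrite <- E. field. exact w0.
Qed.

(** * The expansion of the square root *)

Lemma Cpseries_near_0 (c : nat -> C) (z0 w0 : C) : z0 <> 0 -> Cpseries c z0 w0 ->
  forall eps : R, (0 < eps)%R -> exists r : R, (0 < r)%R /\
    forall z w, (Cmod z < r)%R -> Cpseries c z w -> Rlt (Cmod (w - c O)) eps.
Proof.
intros Hz H eps He. pose proof (proj1 (Cmod_gt_0 z0) Hz) as Hz'. clear Hz.
destruct (Cpseries_lipschitz c z0 w0) as [K [K0 HK]]; [apply Cmod_gt_0; exact Hz'|exact H|].
assert (Hq : (0 < eps / K)%R) by (apply Rdiv_lt_0_compat; lra).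
exists (Rmin (Cmod z0 / 4) (eps / K)). split. { apply Rmin_glb_lt; lra. }
intros z w Hz2 Hw.
pose proof (Rmin_l (Cmod z0 / 4) (eps / K)). pose proof (Rmin_r (Cmod z0 / 4) (eps / K)).
specialize (HK z 0 w (c O)). rewrite Cmod_0 in HK.
specialize (HK ltac:(lra) ltac:(lra) Hw (Cpseries_0 c)).
replace (z - 0) with z in HK by ring.
eapply Rle_lt_trans. exact HK.
apply Rlt_le_trans with (K * (eps / K))%R. apply Rmult_lt_compat_l; lra. right. field. lra.
Qed.

Lemma Cmod_inv_Cexp_small (r : R) : (0 < r)%R -> exists M : R, forall x : R, (M < x)%R ->
  (Cmod (/ Cexp x) < r)%R.
Proof.
intros Hr. destruct (exp_small r Hr) as [M HM]. exists (- M)%R. intros x Hx.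
rewrite <- Cexp_opp, Cmod_Cexp. simpl. apply HM. lra.
Qed.

Lemma Cpseries_decr (c : nat -> C) (z w : C) : z <> 0 -> Cpseries c z w ->
  Cpseries (fun k => c (S k)) z ((w - c O) / z).
Proof.
intros Hz H.
pose proof (is_pseries_decr_1 (K := C_AbsRing) (V := C_NormedModule) c z (/ z) w) as Q.
assert (E : (w - c O) / z = / z * (w + - c O)) by (field; exact Hz).
unfold Cpseries. rewrite E. apply Q. 2: exact H.
change (/ z * z = 1). apply Cinv_l. exact Hz.
Qed.

(** The constant terms agree in the limit [x -> +oo], and the series shifted by one index
    again have the same sum. *)
Lemma Cpseries_identity (T : R) : forall (k : nat) (c c' : nat -> C),
  (forall x : R, (T < x)%R -> exists w, Cpseries c (/ Cexp x) w /\ Cpseries c' (/ Cexp x) w) ->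
  c k = c' k.
Proof.
assert (H0 : forall c c' : nat -> C,
  (forall x : R, (T < x)%R -> exists w, Cpseries c (/ Cexp x) w /\ Cpseries c' (/ Cexp x) w) ->
  c O = c' O).
{ intros c c' H.
  assert (NZ : / Cexp (T + 1)%R <> 0). { rewrite <- Cexp_opp. apply Cexp_neq_0. }
  destruct (H (T + 1)%R) as [w0 [A0 B0]]; [lra|].
  apply Ceq_minus, Cmod_eq_0. apply Rle_antisym; [|apply Cmod_ge_0].
  apply Rle_plus_epsilon. intros eps He.
  destruct (Cpseries_near_0 c _ _ NZ A0 (eps / 2)%R) as [r1 [R1 H1]]; [lra|].
  destruct (Cpseries_near_0 c' _ _ NZ B0 (eps / 2)%R) as [r2 [R2 H2]]; [lra|].
  destruct (Cmod_inv_Cexp_small (Rmin r1 r2)) as [M HM]; [apply Rmin_glb_lt; assumption|].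
  set (x := (Rmax M T + 1)%R).
  pose proof (Rmax_l M T). pose proof (Rmax_r M T).
  specialize (HM x ltac:(unfold x; lra)).
  destruct (H x ltac:(unfold x; lra)) as [w [A B]].
  pose proof (Rmin_l r1 r2). pose proof (Rmin_r r1 r2).
  specialize (H1 (/ Cexp x) w ltac:(lra) A). specialize (H2 (/ Cexp x) w ltac:(lra) B).
  replace (c O - c' O) with (- (w - c O) + (w - c' O)) by ring.
  eapply Rle_trans. apply Cmod_triangle. rewrite Cmod_opp. lra. }
induction k as [|k IH]; intros c c' H; [apply H0, H|].
apply (IH (fun k => c (S k)) (fun k => c' (S k))).
intros x Hx. destruct (H x Hx) as [w [A B]]. exists ((w - c O) / / Cexp x).
assert (NZ : / Cexp x <> 0). { rewrite <- Cexp_opp. apply Cexp_neq_0. }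
split; [apply Cpseries_decr; assumption|].
rewrite (H0 c c' H). apply Cpseries_decr; assumption.
Qed.

Lemma Cpseries_scale c tau z w : Cpseries c (tau * z) w -> Cpseries (fun k => Cpow tau k * c
  k) z w.
Proof.
intros H. rewrite Cpseries_eps in H |- *.
assert (E : forall n, partial_sum (fun k => Cpow tau k * c k) z n = partial_sum c (tau * z) n).
{ induction n as [|n IH]. simpl; ring. cbn [partial_sum]. rewrite IH, Cpow_mult_l. ring. }
intros eps He. destruct (H eps He) as [N HN]. exists N. intros n Hn. rewrite E. apply HN.
  exact Hn.
Qed.

Lemma sqrt_expansion_square {m} (a : Tn m C) b : is_sqrt_expansion a b ->
  b O = 1 /\ exists T : R, forall t : C, (T < Re t)%R -> exists w : C,
   Cpseries b (/ Cexp t) w /\ w * w = P a (Cexp t) * cover_pow t (- INR m).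
Proof.
intros [B0 [T H]]. split; [exact B0|]. exists T. intros t Ht.
destruct (H t Ht) as [w [Hw E]]. exists w. split; [exact Hw|].
pose proof (Cexp_neq_0 t) as N.
assert (E2 : cover_pow t (INR m / 2 - 1) * cover_pow t (INR m / 2 - 1) * Cpow (Cexp t) 2 *
  cover_pow t (- INR m) = 1).
{ simpl. rewrite <- (cover_pow_1 t) at 1 2. rewrite Cmult_1_r, <- !cover_pow_plus.
  replace (INR m / 2 - 1 + (INR m / 2 - 1) + (1 + 1) + - INR m) with (RtoC 0) by field. apply
    cover_pow_0. }
replace (P a (Cexp t)) with (P a (Cexp t) / Cpow (Cexp t) 2 * Cpow (Cexp t) 2) by (field;
  exact N).
rewrite <- E.
replace (Cpow (cover_pow t (INR m / 2 - 1) * w) 2 * Cpow (Cexp t) 2 * cover_pow t (- INR m))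
  with
 (cover_pow t (INR m / 2 - 1) * cover_pow t (INR m / 2 - 1) * Cpow (Cexp t) 2 * cover_pow t
   (- INR m) * (w * w)) by (simpl; ring).
rewrite E2. ring.
Qed.

(** The sums of both series have the same square, [P(x) x^(-m)], and both tend to [1], so
    they do not differ in sign. *)
Lemma sqrt_expansion_weighted_scale {m} (a : Tn m C) b b' d :
  Re d = 0%R -> Cpow (Cexp d) m = 1 ->
  is_sqrt_expansion a b -> is_sqrt_expansion (weighted_scale (Cexp d) a) b' ->
  forall k, b' k = Cpow (Cexp d) k * b k.
Proof.
intros Rd Hd H H' k.
destruct (sqrt_expansion_square _ _ H) as [B0 [T1 H1]].
destruct (sqrt_expansion_square _ _ H') as [B0' [T2 H2]].
assert (Q : forall x : R, (Rmax T1 T2 < x)%R -> exists w1 w2,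
  Cpseries b' (/ Cexp x) w1 /\ Cpseries (fun k => Cpow (Cexp d) k * b k) (/ Cexp x) w2 /\ w1
    * w1 = w2 * w2).
{ intros x Hx. pose proof (Rmax_l T1 T2). pose proof (Rmax_r T1 T2).
  destruct (H2 x) as [w1 [A1 E1]]; [simpl; lra|].
  destruct (H1 (x - d)) as [w2 [A2 E2]].
  { replace (Re (x - d)) with (x - Re d)%R by (destruct d; reflexivity). lra. }
  exists w1, w2. split; [exact A1|]. split.
  - apply Cpseries_scale. replace (Cexp d * / Cexp x) with (/ Cexp (x - d)); [exact A2|].
    rewrite <- !Cexp_opp, <- Cexp_plus. f_equal. ring.
  - rewrite E1, E2.
    replace (Cexp x) with (Cexp d * Cexp (x - d)) by (rewrite <- Cexp_plus; f_equal; ring).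
    rewrite P_weighted_scale by exact Hd. f_equal.
    replace (x - d) with (x + - d) by ring. rewrite cover_pow_shift. unfold cover_pow at 3.
    replace (- INR m * - d) with (INR m * d) by ring. rewrite <- Cexp_pow, Hd. ring. }
set (x0 := (Rmax T1 T2 + 1)%R).
assert (NZ : / Cexp x0 <> 0). { rewrite <- Cexp_opp. apply Cexp_neq_0. }
destruct (Q x0 ltac:(unfold x0; lra)) as (u1 & u2 & U1 & U2 & _).
destruct (Cpseries_near_0 _ _ _ NZ U1 1%R) as [r1 [R1 N1]]; [lra|].
destruct (Cpseries_near_0 _ _ _ NZ U2 1%R) as [r2 [R2 N2]]; [lra|].
cbv beta in N2. rewrite B0 in N2. rewrite B0' in N1.
destruct (Cmod_inv_Cexp_small (Rmin r1 r2)) as [M HM]; [apply Rmin_glb_lt; assumption|].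
apply (Cpseries_identity (Rmax M (Rmax T1 T2)) k b' (fun k => Cpow (Cexp d) k * b k)).
intros x Hx. pose proof (Rmax_l M (Rmax T1 T2)). pose proof (Rmax_r M (Rmax T1 T2)).
specialize (HM x ltac:(lra)). pose proof (Rmin_l r1 r2). pose proof (Rmin_r r1 r2).
destruct (Q x ltac:(lra)) as (w1 & w2 & W1 & W2 & E).
specialize (N1 (/ Cexp x) w1 ltac:(lra) W1). specialize (N2 (/ Cexp x) w2 ltac:(lra) W2).
exists w1. split; [exact W1|]. replace w1 with w2; [exact W2|].
symmetry. apply Ceq_minus. destruct (classic (w1 - w2 = 0)) as [Z|Z]; [exact Z|exfalso].
apply (Cmult_neq_0 (w1 - w2) (w1 + w2)); [exact Z| |].
- intros Z2.
  assert (F : Rle (Cmod ((w1 - 1) + (w2 - Cpow (Cexp d) 0 * 1))) (Cmod (w1 - 1) + Cmod (w2 -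
    Cpow (Cexp d) 0 * 1))%R) by apply Cmod_triangle.
  replace ((w1 - 1) + (w2 - Cpow (Cexp d) 0 * 1)) with ((w1 + w2) - 2) in F by (simpl; ring).
  rewrite Z2 in F. replace (0 - 2) with (RtoC (-2)) in F by (rewrite <- RtoC_minus; f_equal;
    lra).
  rewrite Cmod_R, Rabs_left in F; lra.
- replace ((w1 - w2) * (w1 + w2)) with (w1 * w1 - w2 * w2) by ring. rewrite E. ring.
Qed.

(** With [z = 1/x], the sum [w] satisfies [w^2 = 1 + a_1 z + a_2 z^2], so that
    [v = (w - 1) / z], which tends to [b_1], satisfies [v (w + 1) = a_1 + a_2 z]. *)
Lemma sqrt_expansion_1 (a : Tn 2 C) b : is_sqrt_expansion a b -> b 1%nat = coef a 1 / 2.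
Proof.
intros H. destruct (sqrt_expansion_square _ _ H) as [B0 [T HT]].
assert (Q : forall x : R, (T < x)%R -> exists w, Cpseries b (/ Cexp x) w /\
   Cpseries (fun k => b (S k)) (/ Cexp x) ((w - 1) / / Cexp x) /\
   ((w - 1) / / Cexp x) * (w + 1) = coef a 1 + coef a 2 * / Cexp x).
{ intros x Hx. destruct (HT x Hx) as [w [W E]]. exists w.
  pose proof (Cexp_neq_0 x) as N.
  assert (NZ : / Cexp x <> 0). { rewrite <- Cexp_opp. apply Cexp_neq_0. }
  split; [exact W|]. split. { rewrite <- B0. apply Cpseries_decr; assumption. }
  replace ((w - 1) / / Cexp x * (w + 1)) with ((w * w - 1) * Cexp x) by (field; exact N).
  rewrite E. unfold P. rewrite !sum_Sn, sum_O. unfold plus; simpl.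
  replace (cover_pow x (- (1 + 1)%R)) with (/ Cexp x * / Cexp x).
  - field. exact N.
  - rewrite <- Cexp_opp, <- Cexp_plus. unfold cover_pow. f_equal. rewrite RtoC_plus. ring. }
set (x0 := (T + 1)%R).
assert (NZ : / Cexp x0 <> 0). { rewrite <- Cexp_opp. apply Cexp_neq_0. }
destruct (Q x0 ltac:(unfold x0; lra)) as (u & U1 & U2 & _).
assert (E : 2 * b 1%nat - coef a 1 = 0).
{ apply Cmod_eq_0. apply Rle_antisym; [|apply Cmod_ge_0].
  apply Rle_plus_epsilon. intros eps He.
  set (A := (3 + Cmod (b 1%nat) + Cmod (coef a 2))%R).
  assert (A0 : (0 < A)%R) by (unfold A; pose proof (Cmod_ge_0 (b 1%nat)); pose proof
    (Cmod_ge_0 (coef a 2)); lra).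
  set (e := Rmin 1 (eps / A)).
  assert (He1 : (0 < e)%R) by (apply Rmin_glb_lt; [lra|apply Rdiv_lt_0_compat; assumption]).
  assert (He2 : (e <= 1)%R) by apply Rmin_l.
  assert (He3 : (A * e <= eps)%R).
  { pose proof (Rmin_r 1 (eps / A)) as Z. fold e in Z. apply (Rmult_le_compat_l A) in Z; [|lra].
    replace (A * (eps / A))%R with eps in Z by (field; lra). exact Z. }
  destruct (Cpseries_near_0 _ _ _ NZ U1 e He1) as [r1 [R1 N1]].
  destruct (Cpseries_near_0 _ _ _ NZ U2 e He1) as [r2 [R2 N2]].
  clearbody e. destruct (Cmod_inv_Cexp_small (Rmin (Rmin r1 r2) e)) as [M HM]; [repeat apply
    Rmin_glb_lt; lra|].
  set (x := (Rmax M T + 1)%R). pose proof (Rmax_l M T). pose proof (Rmax_r M T).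
  specialize (HM x ltac:(unfold x; lra)).
  pose proof (Rmin_l (Rmin r1 r2) e). pose proof (Rmin_r (Rmin r1 r2) e). pose proof (Rmin_l
    r1 r2). pose proof (Rmin_r r1 r2).
  destruct (Q x ltac:(unfold x; lra)) as (w & W1 & W2 & E).
  specialize (N1 (/ Cexp x) _ ltac:(lra) W1). specialize (N2 (/ Cexp x) _ ltac:(lra) W2).
    rewrite B0 in N1.
  set (v := (w - 1) / / Cexp x) in *. set (z := / Cexp x) in *. clearbody v z.
  cbv beta in N2.
  replace (2 * b 1%nat - coef a 1) with ((- (v - b 1%nat) + - (v - b 1%nat)) + (- (b 1%nat *
    (w - 1)) + (- ((v - b 1%nat) * (w - 1)) + coef a 2 * z))).
  2: { replace (coef a 1) with (v * (w + 1) - coef a 2 * z) by (rewrite E; ring). ring. }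
  eapply Rle_trans. apply Cmod_triangle.
  eapply Rle_trans. apply Rplus_le_compat. apply Cmod_triangle. apply Cmod_triangle.
  eapply Rle_trans. apply Rplus_le_compat_l, Rplus_le_compat_l. apply Cmod_triangle.
  rewrite !Cmod_opp, !Cmod_mult.
  pose proof (Cmod_ge_0 (v - b 1%nat)). pose proof (Cmod_ge_0 (w - 1)). pose proof (Cmod_ge_0
    z).
  pose proof (Cmod_ge_0 (b 1%nat)). pose proof (Cmod_ge_0 (coef a 2)).
  assert (Rle (Cmod (b 1%nat) * Cmod (w - 1)) (Cmod (b 1%nat) * e)) by (apply
    Rmult_le_compat_l; lra).
  assert (Rle (Cmod (v - b 1%nat) * Cmod (w - 1)) (1 * e)) by (apply Rmult_le_compat; lra).
  assert (Rle (Cmod (coef a 2) * Cmod z) (Cmod (coef a 2) * e)) by (apply Rmult_le_compat_l;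
    lra).
  unfold A in He3. lra. }
apply Ceq_minus in E. rewrite <- E. field.
Qed.

(** * The exponential factor at infinity *)

Lemma sum_n_m_opp (f g : nat -> C) (N : nat) : (forall k, f k = - g k) ->
  sum_n_m f 1 N = - sum_n_m g 1 N.
Proof.
intros H. induction N as [|N IH].
- rewrite !sum_n_m_zero by lia. change (RtoC 0 = - 0). ring.
- rewrite !sum_n_Sm by lia. rewrite IH, H. unfold plus; simpl. ring.
Qed.

Section Symmetry.
Context {m : nat} (b b' : nat -> C) (d : C)
  (Hd : Cexp (INR m / 2 * d) = - 1)
  (Hbb : forall k, b' k = Cpow (Cexp d) k * b k).

Lemma r_exp_weighted_scale : r_exp m b' = 1 - INR m / 2 - r_exp m b.
Proof.
unfold r_exp. destruct (Nat.odd m) eqn:O; [field|].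
rewrite Hbb, Cexp_pow.
assert (E : INR (Nat.div2 m) * d = INR m / 2 * d).
{ pose proof (Nat.div2_odd m) as D. rewrite O in D. simpl in D. rewrite !Nat.add_0_r in D.
  rewrite D at 2. rewrite plus_INR, RtoC_plus. field. }
rewrite E, Hd. field.
Qed.

Lemma S_exp_weighted_scale t : S_exp m b' (t + d) = - S_exp m b t.
Proof.
unfold S_exp. rewrite cover_pow_shift. unfold cover_pow at 2. rewrite Hd.
rewrite (sum_n_m_opp (fun k => b' k / (INR m / 2 - INR k) * cover_pow (t + d) (INR m / 2 -
  INR k))
   (fun k => b k / (INR m / 2 - INR k) * cover_pow t (INR m / 2 - INR k))).
{ ring. }
intros k.
rewrite Hbb, cover_pow_shift, Cexp_pow. unfold cover_pow at 2.
replace ((INR m / 2 - INR k) * d) with (INR m / 2 * d + - (INR k * d)) by ring.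
rewrite Cexp_plus, Hd, Cexp_opp.
pose proof (Cexp_neq_0 (INR k * d)) as N. unfold Cdiv.
replace (Cexp (INR k * d) * b k * / (INR m * / 2 - INR k) * (cover_pow t (INR m * / 2 - INR
  k) * (- 1 * / Cexp (INR k * d))))
 with (- 1 * (b k * / (INR m * / 2 - INR k) * cover_pow t (INR m * / 2 - INR k)) * (Cexp (INR
   k * d) * / Cexp (INR k * d))) by ring.
rewrite Cinv_r by exact N. ring.
Qed.
End Symmetry.

(** All powers of [x] in [S] after the first are at most [x^(m/2 - 1)], hence negligible
    against [x^(m/2)]. *)
Lemma lower_terms_bound (m : nat) (c : nat -> C) (N : nat) : exists K : R, (0 <= K)%R /\
  forall x : R, (0 <= x)%R ->
   Rle (Cmod (sum_n_m (fun k => c k * cover_pow x (INR m / 2 - INR k)) 1 N)) (K * exp ((INR m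
     / 2 - 1) * x))%R.
Proof.
induction N as [|N [K [K0 IH]]].
- exists 0%R. split; [lra|]. intros x Hx. rewrite sum_n_m_zero by lia.
  change (Rle (Cmod 0) (0 * exp ((INR m / 2 - 1) * x))). rewrite Cmod_0. lra.
- exists (K + Cmod (c (S N)))%R. pose proof (Cmod_ge_0 (c (S N))) as C0. split; [lra|].
  intros x Hx.
  rewrite sum_n_Sm by lia. unfold plus; simpl.
  eapply Rle_trans. apply Cmod_triangle. rewrite Rmult_plus_distr_r.
  apply Rplus_le_compat; [apply IH; exact Hx|]. rewrite Cmod_mult.
  apply Rmult_le_compat_l; [exact C0|]. unfold cover_pow. rewrite Cmod_Cexp.
  change (match N with O => 1%R | S _ => (INR N + 1)%R end) with (INR (S N)).
  replace (Re ((INR m / 2 - INR (S N)) * x)) with ((INR m / 2 - INR (S N)) * x)%R.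
  + pose proof (le_INR 1 (S N) ltac:(lia)) as L. simpl (INR 1) in L.
    destruct (Req_dec ((INR m / 2 - INR (S N)) * x) ((INR m / 2 - 1) * x)) as [->|D]; [lra|].
    left. apply exp_increasing. nra.
  + replace (RtoC (INR m) / 2) with (RtoC (INR m / 2)) by (rewrite RtoC_div by lra;
    reflexivity).
    rewrite <- RtoC_minus, <- RtoC_mult. reflexivity.
Qed.

(** The leading term [(2/m) e^(m x / 2)] exceeds the others by at least half of itself,
    and [e^(m x / 2) >= e^(x / 2) >= (1 + x / 4)^2].  A quadratic lower bound suffices to
    dominate the linear exponents of [exponential_decay]. *)
Lemma S_exp_growth (n : nat) (b : nat -> C) : exists T : R, forall x : R, (T <= x)%R ->
  (x * x / (16 * INR (S n)) <= Re (S_exp (S n) b x))%R.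
Proof.
set (m := S n).
assert (M1 : (1 <= INR m)%R) by (apply (le_INR 1); unfold m; lia).
destruct (lower_terms_bound m (fun k => b k / (INR m / 2 - INR k)) (Nat.div2 (m - 1))) as [K
  [K0 HK]].
assert (Hq : (0 < / (INR m * (K + 1)))%R) by (apply Rinv_0_lt_compat; nra).
destruct (exp_small _ Hq) as [M HM].
exists (Rmax 0 (- M + 1)). intros x Hx.
pose proof (Rmax_l 0 (- M + 1)). pose proof (Rmax_r 0 (- M + 1)).
specialize (HK x ltac:(lra)). specialize (HM (- x)%R ltac:(lra)).
unfold S_exp. cbv beta in HK.
set (s := sum_n_m _ _ _) in *.
set (Y := exp (INR m / 2 * x)%R).
assert (EY : cover_pow x (INR m / 2) = RtoC Y).
{ unfold cover_pow. replace (RtoC (INR m) / 2 * x) with (RtoC (INR m / 2 * x)).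
  apply Cexp_R. rewrite RtoC_mult, RtoC_div by lra. reflexivity. }
rewrite EY.
replace (exp ((INR m / 2 - 1) * x)) with (Y * exp (- x))%R in HK.
2: { unfold Y. rewrite <- exp_plus. f_equal. ring. }
assert (Y0 : (0 < Y)%R) by apply exp_pos.
assert (Y1 : (x * x / 16 <= Y)%R).
{ apply Rle_trans with (exp (x / 4) * exp (x / 4))%R.
  - pose proof (exp_ineq1_le (x / 4)). nra.
  - rewrite <- exp_plus. unfold Y. destruct (Req_dec (x / 4 + x / 4) (INR m / 2 * x)) as
    [->|D]; [lra|].
    left. apply exp_increasing. nra. }
assert (B : (Cmod s <= / INR m * Y)%R).
{ eapply Rle_trans. exact HK.
  apply Rle_trans with (K * (Y * / (INR m * (K + 1))))%R.
  - apply Rmult_le_compat_l; [exact K0|]. apply Rmult_le_compat_l; lra.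
  - replace (K * (Y * / (INR m * (K + 1))))%R with (/ INR m * Y * (K / (K + 1)))%R by (field;
    lra).
    rewrite <- (Rmult_1_r (/ INR m * Y)) at 2. apply Rmult_le_compat_l.
    + apply Rmult_le_pos; [|lra]. left. apply Rinv_0_lt_compat. lra.
    + apply (Rmult_le_reg_r (K + 1)); [lra|]. replace (K / (K + 1) * (K + 1))%R with K by
      (field; lra). lra. }
assert (RS : (Re (2 / INR m * Y + s) = 2 / INR m * Y + Re s)%R).
{ replace (2 / RtoC (INR m) * Y) with (RtoC (2 / INR m * Y)) by (rewrite RtoC_mult, RtoC_div
  by lra; reflexivity).
  destruct s; reflexivity. }
rewrite RS.
pose proof (re_le_Cmod s) as Rs. apply Rabs_le_between in Rs.
assert (I0 : (0 < / INR m)%R) by (apply Rinv_0_lt_compat; lra).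
replace (x * x / (16 * INR m))%R with (/ INR m * (x * x / 16))%R by (field; lra).
assert (/ INR m * (x * x / 16) <= / INR m * Y)%R by (apply Rmult_le_compat_l; lra).
unfold Rdiv at 2. lra.
Qed.

Lemma exponential_decay (n : nat) (b : nat -> C) (A B : C) :
  Clim (Rbar_locally p_infty) (fun x : R => Cexp (A * x + B - 2 * S_exp (S n) b x)) 0.
Proof.
intros eps He. destruct (S_exp_growth n b) as [T HT].
set (c := (/ (8 * INR (S n)))%R).
assert (M1 : (1 <= INR (S n))%R) by (apply (le_INR 1); lia).
assert (c0 : (0 < c)%R) by (apply Rinv_0_lt_compat; lra).
set (D := (Rabs (Re A) + Rabs (Re B) + Rabs (ln eps) + 1)%R).
exists (Rmax (Rmax T 1) (D / c)). intros x Hx.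
pose proof (Rmax_l (Rmax T 1) (D / c)). pose proof (Rmax_r (Rmax T 1) (D / c)).
pose proof (Rmax_l T 1). pose proof (Rmax_r T 1).
specialize (HT x ltac:(lra)).
replace (Cexp (A * x + B - 2 * S_exp (S n) b x) - 0) with (Cexp (A * x + B - 2 * S_exp (S n)
  b x)) by ring.
rewrite Cmod_Cexp, <- (exp_ln eps He). apply exp_increasing.
replace (Re (A * x + B - 2 * S_exp (S n) b x)) with (Re A * x + Re B - 2 * Re (S_exp (S n) b
  x))%R.
2: { destruct A, B, (S_exp (S n) b x). simpl. ring. }
assert (E : (2 * (x * x / (16 * INR (S n))) = c * (x * x))%R) by (unfold c; field; lra).
assert (Q : (D < c * x)%R).
{ assert (Dx : (D / c < x)%R) by lra. apply (Rmult_lt_compat_l c) in Dx; [|exact c0].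
  replace (c * (D / c))%R with D in Dx by (field; lra). exact Dx. }
assert (Q2 : (D * x <= c * (x * x))%R) by nra.
pose proof (Rle_abs (Re A)). pose proof (Rle_abs (Re B)).
assert (L : (- Rabs (ln eps) <= ln eps)%R). { pose proof (Rle_abs (- ln eps)). rewrite
  Rabs_Ropp in H5. lra. }
pose proof (Rabs_pos (Re B)). pose proof (Rabs_pos (ln eps)).
assert (Re A * x <= Rabs (Re A) * x)%R by (apply Rmult_le_compat_r; lra).
unfold D in Q2. nra.
Qed.

(** * Asymptotics on the positive real axis *)

(** The inverse of the expected behaviour [x^r e^(-S)]. *)
Definition normalizer (m : nat) (b : nat -> C) (t : C) : C :=
  cover_pow t (- r_exp m b) * Cexp (S_exp m b t).

Lemma arg_step_Ci n : arg_step (S n) = Ci * RtoC (2 * PI / INR (S n))%R.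
Proof.
unfold arg_step. rewrite RtoC_div, RtoC_mult. field. apply RtoC_INR_S_neq_0. apply not_0_INR.
  lia.
Qed.

Section Infinity.
Context {n : nat} (b : Tn (S n) C -> nat -> C) (Phi0 : C -> Tn (S n) C -> C)
  (Hb : forall a, is_sqrt_expansion a (b a))
  (HPhi0 : is_Phi0 (S n) b Phi0).

(** The rotated point has argument [2 pi k / m], inside the sector of validity
    [|arg x| < 3 pi / m] because [|k| <= 1]; only the first term of the expansion is
    used. *)
Lemma Phi_limit (k : Z) (a : Tn (S n) C) : (-1 <= k <= 1)%Z ->
  Clim (Rbar_locally p_infty)
    (fun x : R => normalizer (S n) (b (weighted_scale (Cexp (IZR k * arg_step (S n))) a)) (x
      + IZR k * arg_step (S n))
                  * Phi_ Phi0 k x a) 1.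
Proof.
intros Hk. destruct HPhi0 as [_ (phi & phi0 & H)].
set (ak := weighted_scale (Cexp (IZR k * arg_step (S n))) a).
pose proof (lt_0_INR (S n) ltac:(lia)) as M0. pose proof PI_RGT_0 as Pi0.
assert (Q0 : (0 < PI / INR (S n))%R) by (apply Rdiv_lt_0_compat; assumption).
destruct (H ak (2 * PI / INR (S n))%R O) as (delta & K & T & D0 & HH).
{ replace (2 * PI / INR (S n))%R with (2 * (PI / INR (S n)))%R by (field; lra).
  replace (3 * PI / INR (S n))%R with (3 * (PI / INR (S n)))%R by (field; lra). lra. }
set (sg := series_step (S n)) in *.
assert (S0 : (0 < sg)%R) by (unfold sg, series_step; destruct (Nat.odd (S n)); lra).
intros eps He.
assert (K1 : (0 < Rabs K + 1)%R) by (pose proof (Rabs_pos K); lra).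
destruct (exp_small (eps / (Rabs K + 1))) as [M HM]; [apply Rdiv_lt_0_compat; lra|].
exists (Rmax T (- M / sg)). intros x Hx.
pose proof (Rmax_l T (- M / sg)). pose proof (Rmax_r T (- M / sg)).
assert (Hx2 : (sg * (- M / sg) < sg * x)%R) by (apply Rmult_lt_compat_l; lra).
replace (sg * (- M / sg))%R with (- M)%R in Hx2 by (field; lra).
assert (Et : x + IZR k * arg_step (S n) = (x, (IZR k * (2 * PI / INR (S n)))%R)).
{ rewrite arg_step_Ci. unfold Ci, RtoC, Cmult, Cplus; simpl. f_equal; ring. }
specialize (HH ak (x + IZR k * arg_step (S n))).
assert (HH' := HH (fun i _ => ltac:(replace (coeff_Tn (RtoC 0) ak i - coeff_Tn (RtoC 0) ak i)
  with (RtoC 0) by ring; rewrite Cmod_0; exact D0))).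
clear HH.
assert (ReE : Re (x + IZR k * arg_step (S n)) = x) by (rewrite Et; reflexivity).
assert (ImE : Im (x + IZR k * arg_step (S n)) = (IZR k * (2 * PI / INR (S n)))%R) by (rewrite
  Et; reflexivity).
rewrite ReE, ImE in HH'.
assert (B := HH' ltac:(lra)). clear HH'.
assert (A : (Rabs (IZR k * (2 * PI / INR (S n))) <= 2 * PI / INR (S n))%R).
{ rewrite Rabs_mult. rewrite (Rabs_pos_eq (2 * PI / INR (S n))).
  2: { unfold Rdiv. apply Rmult_le_pos. lra. left. apply Rinv_0_lt_compat. exact M0. }
  rewrite <- (Rmult_1_l (2 * PI / INR (S n))) at 2. apply Rmult_le_compat_r.
  { unfold Rdiv. apply Rmult_le_pos. lra. left. apply Rinv_0_lt_compat. exact M0. }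
  rewrite <- abs_IZR. apply (IZR_le _ 1). lia. }
specialize (B A). clear A.
rewrite sum_O, phi0 in B.
replace (1 * cover_pow (x + IZR k * arg_step (S n)) (- (INR 0 * sg))) with (RtoC 1) in B.
2: { simpl. rewrite Cmult_0_l, Copp_0, cover_pow_0. ring. }
unfold normalizer. unfold Phi_. fold ak. rewrite rotate_arg_step, omega_pow_arg_step. fold ak.
eapply Rle_lt_trans. exact B.
change (INR 1) with 1%R. rewrite Rmult_1_l.
specialize (HM (- (sg * x))%R ltac:(lra)).
pose proof (exp_pos (- (sg * x))). pose proof (Rle_abs K).
apply Rle_lt_trans with ((Rabs K + 1) * exp (- (sg * x)))%R.
{ apply Rmult_le_compat_r; lra. }
apply Rlt_le_trans with ((Rabs K + 1) * (eps / (Rabs K + 1)))%R.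
{ apply Rmult_lt_compat_l; lra. }
right. field. lra.
Qed.

Lemma Cexp_half_turn (k : Z) : k = 1%Z \/ k = (-1)%Z -> Cexp (INR (S n) / 2 * (IZR k *
  arg_step (S n))) = - 1.
Proof.
intros [-> | ->].
- replace (INR (S n) / 2 * (1 * arg_step (S n))) with (Ci * PI) by (unfold arg_step; field;
  apply RtoC_INR_S_neq_0).
  apply Cexp_iPI.
- replace (INR (S n) / 2 * (-1 * arg_step (S n))) with (- (Ci * PI)) by (unfold arg_step;
  field; apply RtoC_INR_S_neq_0).
  rewrite Cexp_opp, Cexp_iPI. field.
Qed.

Lemma Re_scal_arg_step (k : Z) : Re (IZR k * arg_step (S n)) = 0%R.
Proof. rewrite re_scal_l, Re_arg_step. ring. Qed.

Lemma normalizer_rotate (k : Z) a t : k = 1%Z \/ k = (-1)%Z ->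
  normalizer (S n) (b (weighted_scale (Cexp (IZR k * arg_step (S n))) a)) (t + IZR k *
    arg_step (S n))
  = Cexp ((r_exp (S n) (b a) - 1 + INR (S n) / 2) * (t + IZR k * arg_step (S n)) - S_exp (S
    n) (b a) t).
Proof.
intros Hk.
pose proof (sqrt_expansion_weighted_scale a _ _ _ (Re_scal_arg_step k) (Cexp_full_turn n k)
  (Hb a) (Hb _)) as E.
unfold normalizer.
rewrite (r_exp_weighted_scale _ _ _ (Cexp_half_turn k Hk) E).
rewrite (S_exp_weighted_scale _ _ _ (Cexp_half_turn k Hk) E).
unfold cover_pow. rewrite <- Cexp_plus. f_equal. ring.
Qed.

Lemma normalizer_ratio (k : Z) a : k = 1%Z \/ k = (-1)%Z -> exists e : R -> C,
  Clim (Rbar_locally p_infty) e 0 /\ forall x : R,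
  normalizer (S n) (b (weighted_scale (Cexp (IZR k * arg_step (S n))) a)) (x + IZR k *
    arg_step (S n))
  = e x * normalizer (S n) (b a) x.
Proof.
intros Hk. set (r := r_exp (S n) (b a)). set (d := IZR k * arg_step (S n)).
exists (fun x : R => Cexp ((r + (r - 1 + INR (S n) / 2)) * x + (r - 1 + INR (S n) / 2) * d -
  2 * S_exp (S n) (b a) x)).
split; [apply exponential_decay|]. intros x. unfold d. rewrite normalizer_rotate by exact Hk.
unfold normalizer, cover_pow. fold r. rewrite <- !Cexp_plus. f_equal. ring.
Qed.

Lemma Phi_0_limit a : Clim (Rbar_locally p_infty) (fun x : R => normalizer (S n) (b a) x *
  Phi0 x a) 1.
Proof.
pose proof (Phi_limit 0 a ltac:(lia)) as H.
apply (Clim_ext _ _ (fun x : R => normalizer (S n) (b a) x * Phi0 x a)) in H; [exact H|].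
intros x. rewrite Cmult_0_l, Cexp_0, weighted_scale_1, Cplus_0_r, Phi_0. reflexivity.
Qed.

(** After multiplication by the normalizer of [Phi_(-1)], the term in [Phi_0] tends to
    [0], and the normalizers of [Phi_(-1)] and [Phi_1] have a constant ratio. *)
Lemma C0t_eq (C0 C0t : Tn (S n) C -> C)
  (HC0 : forall a t, Phi_ Phi0 (-1) t a = C0 a * Phi0 t a + C0t a * Phi_ Phi0 1 t a) a :
  C0t a = omega_pow (S n) (2 * r_exp (S n) (b a) - 2).
Proof.
set (r := r_exp (S n) (b a)). set (d := arg_step (S n)).
destruct (normalizer_ratio (-1) a (or_intror eq_refl)) as [e [Le Ee]].
pose proof (Phi_limit (-1) a ltac:(lia)) as Lm.
pose proof (Phi_limit 1 a ltac:(lia)) as Lp.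
set (q := Cexp (- (2 * (r - 1 + INR (S n) / 2)) * d)).
assert (E : RtoC 1 = C0 a * 0 + C0t a * q).
{ apply (Clim_unique (Rbar_locally p_infty) _ _ _ Lm).
  apply (Clim_ext _ (fun x : R => C0 a * (e x * (normalizer (S n) (b a) x * Phi0 x a)) +
     C0t a * (q * (normalizer (S n) (b (weighted_scale (Cexp (1 * arg_step (S n))) a)) (x + 1
       * arg_step (S n)) * Phi_ Phi0 1 x a)))).
  - intros x. rewrite HC0.
    assert (N : normalizer (S n) (b (weighted_scale (Cexp (-1 * arg_step (S n))) a)) (x + -1
      * arg_step (S n)) =
      q * normalizer (S n) (b (weighted_scale (Cexp (1 * arg_step (S n))) a)) (x + 1 *
        arg_step (S n))).
    { rewrite (normalizer_rotate (-1)), (normalizer_rotate 1) by tauto. unfold q. rewrite <-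
      Cexp_plus. f_equal. fold r d. ring. }
    rewrite Cmult_plus_distr_l.
    replace (C0 a * (e x * (normalizer (S n) (b a) x * Phi0 x a))) with (e x * normalizer (S
      n) (b a) x * (C0 a * Phi0 x a)) by ring.
    rewrite <- Ee, N. ring.
  - apply Clim_plus. apply Rbar_locally_filter.
    + apply Clim_mult. apply Rbar_locally_filter. apply Clim_const, Rbar_locally_filter.
      eapply Clim_eq. apply Clim_mult. apply Rbar_locally_filter. exact Le. apply
        Phi_0_limit. ring.
    + apply Clim_mult. apply Rbar_locally_filter. apply Clim_const, Rbar_locally_filter.
      eapply Clim_eq. apply Clim_mult. apply Rbar_locally_filter. apply Clim_const,
        Rbar_locally_filter. exact Lp. ring. }
assert (Eq : q * omega_pow (S n) (2 * r - 2) = 1).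
{ unfold q. rewrite omega_pow_arg_step, <- Cexp_plus.
  replace (- (2 * (r - 1 + INR (S n) / 2)) * d + (2 * r - 2) * arg_step (S n)) with (- (2 *
    Ci * PI)).
  - rewrite Cexp_opp, Cexp_2iPI. field.
  - unfold d, arg_step. field. apply RtoC_INR_S_neq_0. }
rewrite <- (Cmult_1_r (C0t a)), <- Eq.
replace (C0t a * (q * omega_pow (S n) (2 * r - 2))) with ((C0 a * 0 + C0t a * q) * omega_pow
  (S n) (2 * r - 2)) by ring.
rewrite <- E. ring.
Qed.

Lemma Phi_1_not_multiple a kappa : ~ (forall t, Phi_ Phi0 1 t a = kappa * Phi0 t a).
Proof.
intros H. apply C1_nz.
destruct (normalizer_ratio 1 a (or_introl eq_refl)) as [e [Le Ee]].
apply (Clim_unique (Rbar_locally p_infty) _ _ _ (Phi_limit 1 a ltac:(lia))).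
apply (Clim_ext _ (fun x : R => kappa * (e x * (normalizer (S n) (b a) x * Phi0 x a)))).
- intros x. rewrite H, Ee. ring.
- eapply Clim_eq.
  + apply Clim_mult. apply Rbar_locally_filter. apply Clim_const, Rbar_locally_filter.
    apply Clim_mult. apply Rbar_locally_filter. exact Le. apply Phi_0_limit.
  + ring.
Qed.
End Infinity.

(** For [m = 1] rotation is the full turn around the origin and fixes [a], and it
    multiplies [f1] by a constant.  If [L0t = 0], then [Phi_(-1)], [Phi_0], [Phi_1] are
    successive multiples of [f1] with that same ratio. *)
Lemma L0t_neq_0 (b : Tn 1 C -> nat -> C) (Phi0 : C -> Tn 1 C -> C)
  (Hb : forall a, is_sqrt_expansion a (b a)) (HPhi0 : is_Phi0 1 b Phi0)
  (f1 f2 : C -> Tn 0 C -> C -> C) (Hf : is_origin_system f1 f2) (L0 L0t : Tn 0 C -> C -> C)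
  (HL0 : forall a' p, admissible p -> forall t,
     Phi_ Phi0 (-1) t (with_p a' p) = L0 a' p * f1 t a' p + L0t a' p * f2 t a' p)
  a' p : admissible p -> L0t a' p <> 0.
Proof.
intros Ap Z. set (d := 1%R * arg_step 1).
assert (Ed : Cexp d = 1).
{ unfold d, arg_step. etransitivity; [|apply Cexp_2iPI]. f_equal. simpl. field. }
destruct (f1_frobenius f1 f2 Hf a' p Ap) as (g & _ & _ & Eg).
assert (Mon : forall t, f1 (t + d) a' p = cover_pow d (s p) * f1 t a' p).
{ intros t. rewrite !Eg, cover_pow_shift, Cexp_plus, Ed, Cmult_1_r. ring. }
set (a := with_p a' p).
assert (Step : forall k t, Phi_ Phi0 (k + 1) t a = Phi_ Phi0 k (t + d) a).
{ intros k t. rewrite <- Phi_rotate. fold d. rewrite Ed, weighted_scale_1. reflexivity. }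
assert (E0 : forall t, Phi0 t a = cover_pow d (s p) * Phi_ Phi0 (-1) t a).
{ intros t. rewrite <- Phi_0. change 0%Z with (-1 + 1)%Z. rewrite Step. unfold a.
  rewrite !(HL0 a' p Ap), Z, Mon. ring. }
apply (Phi_1_not_multiple b Phi0 Hb HPhi0 a (cover_pow d (s p))). intros t.
change 1%Z with (0 + 1)%Z. rewrite Step, Phi_0, !E0. unfold a.
rewrite !(HL0 a' p Ap), Z, Mon. ring.
Qed.

(** * The Stokes multiplier *)

Lemma Ccos_opp z : Ccos (- z) = Ccos z.
Proof. unfold Ccos. replace (Ci * - z) with (- (Ci * z)) by ring. replace (- - (Ci * z)) with
  (Ci * z) by ring. f_equal. ring. Qed.

Lemma omega_pow_plus n c e : omega_pow (S n) (c + e) = omega_pow (S n) c * omega_pow (S n) e.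
Proof. rewrite !omega_pow_arg_step, <- Cexp_plus. f_equal. ring. Qed.

Lemma omega_pow_opp n c : omega_pow (S n) (- c) * omega_pow (S n) c = 1.
Proof. rewrite <- omega_pow_plus, omega_pow_arg_step. replace ((- c + c) * arg_step (S n))
  with (RtoC 0) by ring. apply Cexp_0. Qed.

Theorem corollary6p6 (n : nat)
  (b : Tn (S n) C -> nat -> C)
  (Phi0 : C -> Tn (S n) C -> C)
  (C0 C0t : Tn (S n) C -> C)
  (f1 f2 : C -> Tn n C -> C -> C)
  (L0 L0t : Tn n C -> C -> C)
  (Hb : forall a, is_sqrt_expansion a (b a))
  (HPhi0 : is_Phi0 (S n) b Phi0)
  (HC0 : forall a t,
     Phi_ Phi0 (-1) t a = C0 a * Phi0 t a + C0t a * Phi_ Phi0 1 t a)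
  (Hf : is_origin_system f1 f2)
  (HL0 : forall a' p, admissible p -> forall t,
     Phi_ Phi0 (-1) t (with_p a' p)
     = L0 a' p * f1 t a' p + L0t a' p * f2 t a' p) :
  let m := S n in
  let omega := omega_pow m 1 in
  let r := fun a => r_exp m (b a) in
  (m = 1%nat ->
     forall (a : Tn (S n) C) (p : C), coef a m = (Cpow p 2 - 1) / 4 ->
       C0 a = - 2 * Ccos (PI * p)) /\
  (m = 2%nat ->
     forall (a' : Tn n C) (p : C), (forall k : nat, p <> - RtoC (INR k)) ->
       C0 (with_p a' p) * L0t (weighted_scale omega a') p
       = - 2 * Ci * Cexp (- (Ci * PI * coef a' 1 / 2))
         * Ccos (PI / 2 * (p + coef a' 1)) * L0t a' p) /\
  ((3 <= m)%nat ->
     forall (a' : Tn n C) (p : C), (forall k : nat, p <> - RtoC (INR k)) ->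
       let ra := r (with_p a' p) in
       C0 (with_p a' p) * L0t (weighted_scale omega a') p
       = omega_pow m (ra - 1 + INR m / 4)
         * (L0t a' p * omega_pow m (- ra + 1 / 2 - INR m / 4 + p / 2)
            + L0t (weighted_scale (Cpow omega 2) a') p
              * omega_pow m (ra - 1 / 2 + INR m / 4 - p / 2))).
Proof.
intros m omega r.
assert (Adm : forall p, (forall k : nat, p <> - RtoC (INR k)) -> admissible p).
{ intros p H k _ E. apply (H k). rewrite <- E. ring. }
assert (Rel : forall a' p, admissible p ->
  C0 (with_p a' p) * L0t (weighted_scale omega a') p
  = omega_pow m (p / 2 - 1 / 2) * L0t a' p
    - omega_pow m (2 * r (with_p a' p) - 3 / 2 - p / 2) * L0t (weighted_scale (Cpow omega 2)
      a') p).
{ intros a' p Ap.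
  pose proof (connection_relation n Phi0 C0 C0t f1 f2 L0 L0t (proj1 HPhi0) HC0 Hf HL0 a' p
    Ap) as E.
  cbv zeta in E. fold m omega in E.
  rewrite (C0t_eq b Phi0 Hb HPhi0 C0 C0t HC0) in E. fold m in E. fold (r (with_p a' p)) in E.
  replace (p / 2 - 1 / 2) with (- (1 - s p)) by (unfold s; field).
  replace (2 * r (with_p a' p) - 3 / 2 - p / 2) with ((2 * r (with_p a' p) - 2) + (1 - s p))
    by (unfold s; field).
  unfold m in *. rewrite omega_pow_plus. rewrite E.
  pose proof (omega_pow_opp n (1 - s p)) as Q.
  set (q := omega_pow (S n) (1 - s p)) in *. set (q' := omega_pow (S n) (- (1 - s p))) in *.
  set (w := omega_pow (S n) (2 * r (with_p a' p) - 2)).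
  match goal with |- ?x * ?y = q' * (?x * (q * ?y) + w * (q * (q * ?z))) - _ =>
    transitivity ((q' * q) * (x * y + w * q * z) - w * q * z) end.
  rewrite Q. ring. ring. }
split; [|split].
- intros Hm. unfold m in Hm. injection Hm as ->.
  assert (Main : forall (a' : Tn 0 C) p, admissible p -> C0 (with_p a' p) = - 2 * Ccos (PI *
    p)).
  { intros a' p Ap.
    pose proof (L0t_neq_0 b Phi0 Hb HPhi0 f1 f2 Hf L0 L0t HL0 a' p Ap) as N.
    pose proof (Rel a' p Ap) as E.
    assert (W1 : omega = 1).
    { unfold omega, omega_pow. etransitivity; [|apply Cexp_2iPI]. f_equal. simpl. field. }
    rewrite W1, Cpow_1_l, weighted_scale_1 in E.
    replace (C0 (with_p a' p)) with (C0 (with_p a' p) * L0t a' p / L0t a' p) by (field; exact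
      N).
    rewrite E. unfold r, r_exp, omega_pow, Ccos. simpl.
    replace (2 * Ci * PI * (p / 2 - 1 / 2) / 1) with (Ci * (PI * p) + - (Ci * PI)) by field.
    replace (2 * Ci * PI * (2 * (1 / 2 - 1 / 4) - 3 / 2 - p / 2) / 1) with (- (Ci * (PI * p))
      + - (2 * Ci * PI)) by field.
    rewrite !Cexp_plus, (Cexp_opp (Ci * PI)), (Cexp_opp (2 * Ci * PI)), Cexp_iPI, Cexp_2iPI.
    field. exact N. }
  intros a p Ha. change (coeff_Tn (RtoC 0) a 0 = (Cpow p 2 - 1) / 4) in Ha.
  set (a' := mk_Tn 0 (fun _ => RtoC 0) : Tn 0 C).
  assert (Ea : forall q, Cpow q 2 = Cpow p 2 -> a = with_p a' q).
  { intros q Hq. apply (coeff_Tn_ext (RtoC 0) (RtoC 0)). intros i Hi.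
    unfold with_p. rewrite coeff_mk_Tn by exact Hi. replace i with O by lia. change (coeff_Tn
      (RtoC 0) a 0 = (Cpow q 2 - 1) / 4).
    rewrite Ha, Hq. reflexivity. }
  destruct (classic (admissible p)) as [Ap|Np].
  + rewrite (Ea p eq_refl). apply Main. exact Ap.
  + assert (Ap : admissible (- p)).
    { intros k Hk E. apply Np. intros j Hj E2.
      assert (Q : RtoC (INR k + INR j) = RtoC 0).
      { rewrite RtoC_plus, <- E, <- E2. ring. }
      apply RtoC_inj in Q. pose proof (le_INR 1 k Hk). simpl in H. pose proof (pos_INR j).
        lra. }
    rewrite (Ea (- p)) by (simpl; ring). rewrite (Main a' (- p) Ap).
    replace (PI * - p) with (- (PI * p)) by ring. rewrite Ccos_opp. reflexivity.
- intros Hm a' p Hp. unfold m in Hm. injection Hm as ->.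
  rewrite (Rel a' p (Adm p Hp)).
  assert (W2 : Cpow omega 2 = 1).
  { unfold omega, omega_pow. rewrite Cexp_pow. etransitivity; [|apply Cexp_2iPI]. f_equal.
    simpl. rewrite RtoC_plus. field. }
  rewrite W2, weighted_scale_1.
  unfold r, r_exp, m. change (Nat.odd 2) with false. change (Nat.div2 2) with 1%nat. cbv iota.
  rewrite (sqrt_expansion_1 _ _ (Hb (with_p a' p))).
  assert (Ec : coef (with_p a' p) 1 = coef a' 1).
  { unfold coef, with_p. rewrite coeff_mk_Tn by lia. reflexivity. }
  rewrite Ec. set (a1 := coef a' 1).
  set (u := Cexp (Ci * PI * p / 2)). set (v := Cexp (Ci * PI * a1 / 2)).
  assert (Ei : Cexp (Ci * PI / 2) = Ci).
  { replace (Ci * PI / 2) with (Ci * RtoC (PI / 2)) by (rewrite RtoC_div by lra; field).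
    rewrite Cexp_iR, cos_PI2, sin_PI2. reflexivity. }
  assert (u0 : u <> 0) by apply Cexp_neq_0. assert (v0 : v <> 0) by apply Cexp_neq_0.
  pose proof Ci_nz as i0.
  assert (I2 : Ci * Ci = - 1) by (unfold Ci, Cmult, RtoC; simpl; f_equal; ring).
  unfold omega_pow, Ccos. simpl INR. rewrite RtoC_plus.
  replace (2 * Ci * PI * (p / 2 - 1 / 2) / (1 + 1)) with (Ci * PI * p / 2 + - (Ci * PI / 2))
    by field.
  replace (2 * Ci * PI * (2 * (1 / 2 - (1 + 1) / 4 - a1 / 2) - 3 / 2 - p / 2) / (1 + 1)) with
   (- (Ci * PI * a1 / 2) + - (Ci * PI * a1 / 2) + - (Ci * PI * p / 2) + (Ci * PI / 2) + - (2
     * Ci * PI)) by field.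
  replace (Ci * (PI / 2 * (p + a1))) with (Ci * PI * p / 2 + Ci * PI * a1 / 2) by field.
  rewrite !Cexp_plus, !Cexp_opp, Cexp_plus, Ei, Cexp_2iPI. fold u v.
  replace (/ Ci) with (- Ci).
  2: { apply (f_equal (fun z => / Ci * z)) in I2. rewrite Cmult_assoc, Cinv_l, Cmult_1_l in
    I2 by exact i0. rewrite I2 at 1. ring. }
  field. split; assumption.
- intros Hm a' p Hp ra. rewrite (Rel a' p (Adm p Hp)). fold ra.
  assert (Pl : forall c e, omega_pow m (c + e) = omega_pow m c * omega_pow m e) by exact
    (omega_pow_plus n).
  assert (Half : omega_pow m (INR m / 2) = - 1).
  { unfold m at 1. rewrite omega_pow_arg_step. replace (INR m / 2 * arg_step (S n)) with (INR
    (S n) / 2 * (IZR 1 * arg_step (S n))) by (unfold m; ring).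
    apply Cexp_half_turn. left. reflexivity. }
  rewrite Cmult_plus_distr_l.
  replace (omega_pow m (ra - 1 + INR m / 4) * (L0t a' p * omega_pow m (- ra + 1 / 2 - INR m /
    4 + p / 2))) with
    (omega_pow m (p / 2 - 1 / 2) * L0t a' p).
  2: { rewrite (Cmult_comm (L0t a' p)), Cmult_assoc, <- Pl. do 2 f_equal. field. }
  set (l := L0t (weighted_scale (Cpow omega 2) a') p).
  rewrite (Cmult_comm l), Cmult_assoc, <- Pl.
  replace (ra - 1 + INR m / 4 + (ra - 1 / 2 + INR m / 4 - p / 2)) with ((2 * ra - 3 / 2 - p /
    2) + INR m / 2) by field.
  rewrite Pl, Half. ring.
Qed.
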